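(* Let $f:S\to S$ be a generalized pseudo-Anosov homeomorphism. Then $f$ has a finite number of orbits of first intersection points.
   Context: A surface $S$ is a smooth closed oriented 2-manifold. A generalized pseudo-Anosov homeomorphism $f:S\to S$ is an orientation-preserving homeomorphism for which there are $\lambda>1$ and two $f$-invariant transverse measured singular foliations $(\mathcal{F}^s,\mu^s)$ (stable) and $(\mathcal{F}^u,\mu^u)$ (unstable), possibly with 1-prong singularities (spines), with $f_*\mu^s=\lambda\mu^s$, $f_*\mu^u=\lambda^{-1}\mu^u$; the convention is that $f$ stretches unstable arcs (measured by $\mu^s$) by $\lambda$ and contracts stable arcs (measured by $\mu^u$) by $\lambda^{-1}$. $\mathbf{Sing}(f)$ is the set of singularities of the foliations; if there are none (torus case), $\mathbf{Sing}(f)$ denotes a fixed nonempty finite $f$-invariant family of periodic points. A stable (unstable) separatrix $F^s(p)$ ($F^u(p)$) of $p\in\mathbf{Sing}(f)$ is a connected component of $L\setminus\{p\}$, where $L$ is the stable (unstable) leaf through $p$ including all its prongs; for $x$ on it, $[p,x]^s$ ($[p,x]^u$) is the arc from $p$ to $x$ in the leaf. A point $x\notin\mathbf{Sing}(f)$ is a first intersection point of $f$ if there are $p,q\in\mathbf{Sing}(f)$, a stable separatrix $F^s(p)$ and an unstable separatrix $F^u(q)$ with $x\in F^s(p)\cap F^u(q)$ and $(p,x]^s\cap(q,x]^u=\{x\}$. *)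

(* Defs.v *)
From HB Require Import structures.
From mathcomp Require Import all_boot all_order all_algebra.
From mathcomp Require Import all_classical all_reals all_analysis.
From mathcomp Require Import complex.
Set Implicit Arguments.
Unset Strict Implicit.
Unset Printing Implicit Defensive.
Import Order.TTheory GRing.Theory Num.Theory.
Import numFieldNormedType.Exports.
Local Open Scope classical_set_scope.
Local Open Scope ring_scope.

(* The plane carries its topology and real differential structure as [R * R];
   complex powers are computed through [cplx]. *)
Notation plane R := (R * R)%type.

Definition cplx (R : realType) (z : plane R) : R[i] := Complex z.1 z.2.

Definition homeomorphism (S : topologicalType) (f : S -> S) : Prop :=
  continuous f /\ exists g : S -> S, [/\ continuous g, cancel f g & cancel g f].

Definition full_orbit (S : Type) (f : S -> S) (x : S) : set S :=
  [set y | exists n, iter n f x = y \/ iter n f y = x].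

Section Surfaces.
Variables (R : realType) (S : topologicalType).

(* [phi] restricts to a homeomorphism from the open set [U] onto an open subset
   of the plane; its values outside [U] are irrelevant. *)
Definition chart (U : set S) (phi : S -> plane R) : Prop :=
  [/\ open U, {within U, continuous phi}, set_inj U phi &
      forall V, open V -> V `<=` U -> open (phi @` V)].

Definition smooth_on (U : set (plane R)) (g : plane R -> plane R) : Prop :=
  forall (vs : seq (plane R)) (z : plane R), U z ->
    differentiable (foldr (fun v h => 'D_v h) g vs) z.

Definition jacobian_det (g : plane R -> plane R) (z : plane R) : R :=
  ('D_(1, 0) g z).1 * ('D_(0, 1) g z).2 - ('D_(1, 0) g z).2 * ('D_(0, 1) g z).1.

Definition smooth_oriented_atlas (atl : set (set S * (S -> plane R))) : Prop :=
  [/\ forall c, atl c -> chart c.1 c.2,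
      forall x, exists2 c, atl c & c.1 x &
      forall c d, atl c -> atl d -> exists tau : plane R -> plane R,
        smooth_on (c.2 @` (c.1 `&` d.1)) tau /\
        forall x, c.1 x -> d.1 x ->
          tau (c.2 x) = d.2 x /\ 0 < jacobian_det tau (c.2 x)].

Definition closed_oriented_surface (atl : set (set S * (S -> plane R))) : Prop :=
  [/\ compact [set: S], hausdorff_space S & smooth_oriented_atlas atl].

(* [f] is only a homeomorphism, so its local degree is read off from winding
   numbers: in oriented charts, the image of each small positively oriented
   circle around [x] winds once, positively, around the image of [x].  The lift
   [theta] of the angle is defined on the whole line. *)
Definition orientation_preserving (atl : set (set S * (S -> plane R)))
    (f : S -> S) : Prop :=
  forall c d x, atl c -> atl d -> c.1 x -> d.1 (f x) ->
  \forall r \near 0^'+, exists (gamma : R -> S) (rho theta : R -> R),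
    [/\ forall t, [/\ c.1 (gamma t), d.1 (f (gamma t)) &
          c.2 (gamma t) = c.2 x + (r * cos t, r * sin t)],
        continuous theta,
        forall t, theta (t + 2 * pi) = theta t + 2 * pi &
        forall t, 0 < rho t /\
          d.2 (f (gamma t)) =
            d.2 (f x) + (rho t * cos (theta t), rho t * sin (theta t))].

End Surfaces.

Section Foliations.
Variables (R : realType) (S : topologicalType).

(* [tmeas F alpha a b] is the transverse measure of the path [alpha] restricted to
   [a, b]; it is meaningful for arcs transverse to the leaves only. *)
Record foliation := Foliation {
  leaf : S -> set S;
  sing : set S;
  tmeas : (R -> S) -> R -> R -> R }.

Definition joined (A : set S) (x y : S) : Prop :=
  exists gamma : R -> S,
    [/\ {within `[0, 1], continuous gamma}, gamma 0 = x, gamma 1 = y &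
        forall t, 0 <= t <= 1 -> A (gamma t)].

(* [w] is a continuous determination of [z ^ (k / 2)] along the path [z]. *)
Definition half_power (k : nat) (z w : R -> plane R) (a b : R) : Prop :=
  {within `[a, b], continuous w} /\
  forall t, a <= t <= b -> cplx (w t) ^+ 2 = cplx (z t) ^+ k.

(* In the chart [phi] centred at [p], the leaves are those of the standard
   [k]-prong foliation h(z ^ (k / 2)) = constant: the paths of [U] that stay in
   a leaf are those along which h(phi ^ (k / 2)) is constant.  With h = Im
   ([snd]) this is the horizontal foliation, whose leaf through 0 consists of
   the [k] rays 0 <= z ^ k, and with h = Re ([fst]) the vertical one; [k = 2] is
   the regular case. *)
Definition leaf_chart (h : plane R -> R) (L : S -> set S) (k : nat) (p : S)
    (U : set S) (phi : S -> plane R) : Prop :=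
  [/\ chart U phi, U p, phi p = 0 &
      forall gamma : R -> S, {within `[0, 1], continuous gamma} ->
        (forall t, 0 <= t <= 1 -> U (gamma t)) ->
        (forall t, 0 <= t <= 1 -> L (gamma 0) (gamma t)) <->
        exists w, half_power k (phi \o gamma) w 0 1 /\
          forall t, 0 <= t <= 1 -> h (w t) = h (w 0)].

(* Near each of its points, the arc crosses the horizontal leaves of some
   regular chart strictly monotonically. *)
Definition transverse_arc (F : foliation) (alpha : R -> S) (a b : R) : Prop :=
  {within `[a, b], continuous alpha} /\
  forall t, a <= t <= b -> ~ sing F (alpha t) /\
    exists (U : set S) (phi : S -> plane R) (e : R),
      [/\ leaf_chart snd (leaf F) 2 (alpha t) U phi, 0 < e &
          forall s s', a <= s <= b -> a <= s' <= b ->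
            `|s - t| < e -> `|s' - t| < e ->
            U (alpha s) /\
            (s < s' -> (phi (alpha s)).2 < (phi (alpha s')).2)].

(* The transverse measure is moreover |d h(z ^ (k / 2))| in the chart.
   Monotonicity of [h \o w] selects the right determination when [k = 2] and the
   arc runs through [p], where w ^ 2 = z ^ 2 would also allow [w] to switch
   between [z] and [- z]. *)
Definition measured_chart (h : plane R -> R) (F : foliation) (k : nat) (p : S)
    (U : set S) (phi : S -> plane R) : Prop :=
  leaf_chart h (leaf F) k p U phi /\
  forall (alpha : R -> S) (w : R -> plane R) (a b : R), a <= b ->
    transverse_arc F alpha a b ->
    (forall t, a <= t <= b -> U (alpha t)) ->
    half_power k (phi \o alpha) w a b ->
    (forall s t, a <= s -> s <= t -> t <= b -> h (w s) <= h (w t)) ->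
    tmeas F alpha a b = h (w b) - h (w a).

(* Prong numbers [k = 1] (spines) are allowed.  Invariance of the transverse
   measure under leaf-preserving isotopies and its positivity on nondegenerate
   arcs are contained in the local form given by [measured_chart]. *)
Definition measured_foliation (F : foliation) : Prop :=
  [/\ (forall x, leaf F x x) /\ (forall x y, leaf F x y -> leaf F x = leaf F y),
      forall x y, leaf F x y -> joined (leaf F x) x y,
      finite_set (sing F),
      forall alpha a b c, a <= b -> b <= c -> transverse_arc F alpha a c ->
        tmeas F alpha a c = tmeas F alpha a b + tmeas F alpha b c &
      forall p, exists (k : nat) (U : set S) (phi : S -> plane R),
        [/\ (0 < k)%N, sing F p <-> k <> 2%N & measured_chart snd F k p U phi]].

(* Around every point, a single chart displays both foliations in standard
   form, one horizontal and the other vertical; in particular they have the same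
   singularities, with the same numbers of prongs. *)
Definition transverse_foliations (Fs Fu : foliation) : Prop :=
  forall p, exists (k : nat) (U : set S) (phi : S -> plane R),
    [/\ (0 < k)%N, sing Fs p <-> k <> 2%N, sing Fu p <-> k <> 2%N,
        measured_chart snd Fs k p U phi & measured_chart fst Fu k p U phi].

Definition preserves_foliation (f : S -> S) (F : foliation) : Prop :=
  (forall x, f @` leaf F x = leaf F (f x)) /\ f @` sing F = sing F.

Definition scales_measure (f : S -> S) (F : foliation) (c : R) : Prop :=
  forall alpha a b, a <= b -> transverse_arc F alpha a b ->
    tmeas F (f \o alpha) a b = c * tmeas F alpha a b.

(* [Fs] is the stable foliation and [Fu] the unstable one.  The measure of [Fs]
   is evaluated on arcs transverse to [Fs], e.g. on unstable arcs, which [f]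
   stretches by [lambda]. *)
Definition generalized_pseudo_Anosov (atl : set (set S * (S -> plane R)))
    (f : S -> S) (Fs Fu : foliation) : Prop :=
  [/\ homeomorphism f /\ orientation_preserving atl f,
      measured_foliation Fs /\ measured_foliation Fu,
      transverse_foliations Fs Fu,
      preserves_foliation f Fs /\ preserves_foliation f Fu &
      exists lambda : R, [/\ 1 < lambda, scales_measure f Fs lambda &
        scales_measure f Fu lambda^-1]].

(* [Sg] is Sing(f): the singularities of the foliations or, if there are none,
   some nonempty finite invariant set of periodic points. *)
Definition singular_family (f : S -> S) (F : foliation) (Sg : set S) : Prop :=
  (sing F !=set0 -> Sg = sing F) /\
  (sing F = set0 ->
    [/\ Sg !=set0, finite_set Sg, f @` Sg = Sg &
        forall x, Sg x -> exists2 n, (0 < n)%N & iter n f x = x]).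

(* Connected components of the leaf minus [p] are meant for the leaf topology,
   where they are the path components.  (For the topology induced by [S], two
   prongs accumulating on each other would lie in the same component.) *)
Definition separatrix (F : foliation) (p : S) (A : set S) : Prop :=
  exists2 x, (leaf F p `\ p) x & A = [set y | joined (leaf F p `\ p) x y].

Definition leaf_arc (A : set S) (x y : S) (I : set S) : Prop :=
  exists gamma : R -> S,
    [/\ {within `[0, 1], continuous gamma}, set_inj `[0, 1] gamma,
        gamma 0 = x /\ gamma 1 = y, I = gamma @` `[0, 1] & I `<=` A].

Definition first_intersection (Fs Fu : foliation) (Sg : set S) (x : S) : Prop :=
  ~ Sg x /\ exists (p q : S) (A B I J : set S),
    [/\ Sg p /\ Sg q, separatrix Fs p A /\ separatrix Fu q B, A x /\ B x,
        leaf_arc (leaf Fs p) p x I /\ leaf_arc (leaf Fu q) q x J &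
        (I `\ p) `&` (J `\ q) = [set x]].

End Foliations.

(* Main.v *)
Require Import Defs.
From HB Require Import structures.
From mathcomp Require Import all_boot all_order all_algebra.
From mathcomp Require Import all_classical all_reals all_analysis.
From mathcomp Require Import complex ring lra.
Set Implicit Arguments.
Unset Strict Implicit.
Unset Printing Implicit Defensive.
Import Order.TTheory GRing.Theory Num.Theory.
Import numFieldNormedType.Exports.
Local Open Scope classical_set_scope.
Local Open Scope ring_scope.

(* An arc starting at a singularity p is determined near p by its prong, and
   two arcs without interior singularities that follow the same prong are
   nested. Since f expands the transverse measure of unstable arcs and every
   compact arc has finite measure, the iterates of an unstable arc cannot
   stay infinitely often inside a fixed arc; applied to f and to its inverse,
   this first rules out saddle connections, since there are only finitely
   many prongs.
   Now fix one first intersection point x_c, with stable arc I_c and unstable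
   arc J_c, for each pair c of prongs that carries one. Along the orbit y_n
   of any first intersection point y, with arcs I_n and J_n and prongs c(n),
   the arc J_n is inside J_c(n) for some n in the past and contains it for
   some n in the future. So there is n with J_n inside J_c(n) and J_c(n+1)
   inside J_(n+1). The second inclusion puts x_c(n+1) on J_(n+1); if I_(n+1)
   contained I_c(n+1), then x_c(n+1) would be on both arcs of y_(n+1), hence
   equal to it. In all cases y_(n+1) is on I_c(n+1) and on f(J_c(n)), and a
   stable and an unstable arc meet in finitely many points by transversality
   and compactness. *)

(** * Real functions on intervals *)

Section RealLine.
Variable R : realType.
Implicit Types (a b s t : R) (r : seq R).

(** The retraction of the line onto [[0, 1]]. Precomposing with it makes a path that is continuous
    within [[0, 1]] continuous on the whole line, the form in which arcs are handled below. *)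
Definition clamp (t : R) : R := Num.max 0 (Num.min t 1).

Lemma clamp_itv t : 0 <= clamp t <= 1.
Proof. by rewrite /clamp le_max lexx/= ge_max ler01/= ge_min lexx orbT. Qed.

Lemma clamp_id t : 0 <= t <= 1 -> clamp t = t.
Proof. by case/andP => t0 t1; rewrite /clamp (min_idPl t1) (max_idPr t0). Qed.

Lemma continuous_clamp : continuous clamp.
Proof.
move=> t; apply: (@continuous_max R R (cst 0) (id \min cst 1)).
  exact: cst_continuous.
by apply: continuous_min; [exact: cvg_id|exact: cst_continuous].
Qed.

Lemma within_itvP (X : topologicalType) (f : R -> X) a b :
  {within `[a, b], continuous f} <->
  forall t, a <= t <= b -> f x @[x --> within [set` `[a, b]] (nbhs t)] --> f t.
Proof.
rewrite subspace_continuousP; split => h t.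
  by move=> tab; apply: h; rewrite /= in_itv.
by rewrite /= in_itv => /h.
Qed.

Lemma continuous_within_itv (X : topologicalType) (f : R -> X) a b :
  (forall t, a <= t <= b -> {for t, continuous f}) ->
  {within `[a, b], continuous f}.
Proof.
by move=> h; apply: continuous_in_subspaceT => t; rewrite inE/= in_itv/= => /h.
Qed.

Lemma within_clamp_continuous (X : topologicalType) (g : R -> X) :
  {within `[0, 1], continuous g} -> continuous (g \o clamp).
Proof.
move=> /within_itvP h t V /= nV.
have /= := h _ (clamp_itv t) V nV.
rewrite nbhs_filterE => hV; have := continuous_clamp hV.
move=> {}hV; apply: filterS (hV : nbhs t _) => s /=; apply.
by rewrite in_itv/= clamp_itv.
Qed.

Lemma avoid_seq r a b : a < b ->
  exists c, a < c < b /\ c \notin r.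
Proof.
(* Strengthened for the induction on the list: a whole subinterval avoids it, and its midpoint is
   the witness. *)
suff H : a < b -> exists a' b', [/\ a <= a', a' < b', b' <= b &
    forall c, a' < c < b' -> c \notin r].
  move=> /H[a' [b' [aa ab bb h]]]; exists ((a' + b') / 2).
  by split; [lra|apply: h; lra].
move=> ab; elim: r => [|x r [a' [b' [aa a'b' bb h]]]]; first by exists a, b.
have [/andP[ax xb]|nx] := boolP (a' < x < b').
  exists a', x; split => //; first by lra.
  move=> c hc; rewrite inE negb_or h ?andbT; last by lra.
  by apply/eqP => cx; lra.
exists a', b'; split => // c hc; rewrite inE negb_or h ?andbT//.
by apply/eqP => cx; rewrite -cx hc in nx.
Qed.

Lemma finite_set_min (A : set R) t : finite_set A -> A t ->
  exists2 s, A s & forall s', A s' -> s <= s'.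
Proof.
move=> /finite_seqP[r ->] /=; elim: r t => [//|x r IH] t _.
have [[y yr]|r0] := pselect (exists y, y \in r); last first.
  exists x => [|s']; first by rewrite /= inE eqxx.
  by rewrite /= inE => /orP[/eqP -> //|s'r]; case: r0; exists s'.
case/IH: yr => s /= sr smin.
have [xs|sx] := leP x s.
  exists x => [|s']; first by rewrite /= inE eqxx.
  by rewrite /= inE => /orP[/eqP -> //|/smin]; exact: le_trans.
exists s => [|s']; first by rewrite /= inE sr orbT.
by rewrite /= inE => /orP[/eqP ->|/smin//]; exact: ltW.
Qed.

(** Between two distinct values the intermediate value theorem would produce a value outside the
    finite list. The interval is open at 0 because the direction of an arc has no meaning at its
    initial point. *)
Lemma continuous_finite_constant (c : R -> R) r :
  (forall t, 0 < t <= 1 -> {for t, continuous c}) ->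
  (forall t, 0 < t <= 1 -> c t \in r) ->
  forall s t, 0 < s <= 1 -> 0 < t <= 1 -> c s = c t.
Proof.
move=> cc cr s t; wlog st : s t / s <= t => [H hs ht|hs ht].
  by case: (leP s t) => [st|/ltW ts]; [exact: H|rewrite (H t s)].
apply/eqP/negP => /negP cst.
have : Num.min (c s) (c t) < Num.max (c s) (c t).
  by case: (ltgtP (c s) (c t)) cst.
move=> /(avoid_seq r)[v [/andP[v1 v2] vr]].
have wc : {within `[s, t], continuous c}.
  by apply: continuous_within_itv => x xst; apply: cc; lra.
have := IVT st wc; move/(_ v); rewrite (ltW v1) (ltW v2) => /(_ isT)[x].
by rewrite in_itv/= => xst cxv; move: vr; rewrite -cxv cr//; lra.
Qed.

Lemma injective_increasing (m : R -> R) a b :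
  {within `[a, b], continuous m} ->
  (forall s t, a <= s <= b -> a <= t <= b -> m s = m t -> s = t) ->
  m a <= m b ->
  forall s t, a <= s -> s < t -> t <= b -> m s < m t.
Proof.
move=> cm im mab s t as_ st tb.
have H : {in `[a, b] &, {mono m : x y / x <= y}}.
  by apply: segment_continuous_inj_le => // x y; rewrite !in_itv/=; exact: im.
rewrite (leW_mono_in H) ?in_itv//=; lra.
Qed.

Lemma IVT_le (m : R -> R) a b v :
  a <= b -> {within `[a, b], continuous m} -> m a <= v <= m b ->
  exists2 c, a <= c <= b & m c = v.
Proof.
move=> ab cm hv; have [|c] := @IVT R m a b v ab cm.
  by rewrite ge_min le_max; case/andP: hv => -> ->; rewrite orbT.
by rewrite in_itv/=; exists c.
Qed.

(** The supremum of the [t] with [P 0 t] is attained and equals 1, by additivity and the local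
    condition at that point. The local condition covers the degenerate interval, which gives
    [P 0 0]. This carries the compactness arguments of [arc_tame] and [finite_crossing]. *)
Lemma cousin (P : R -> R -> Prop) :
  (forall x y z, 0 <= x -> x <= y -> y <= z -> z <= 1 ->
     P x y -> P y z -> P x z) ->
  (forall t, 0 <= t <= 1 -> exists2 d, 0 < d &
     (forall x, 0 <= x -> t - d < x -> x <= t -> P x t) /\
     (forall y, y <= 1 -> t <= y -> y < t + d -> P t y)) ->
  P 0 1.
Proof.
move=> Padd Ploc.
pose A := [set t : R | 0 <= t <= 1 /\ P 0 t].
have A0 : A 0.
  split; first by rewrite lexx ler01.
  have [|d d0 [h _]] := Ploc 0; first by rewrite lexx ler01.
  by apply: h => //; lra.
have uA : ubound A 1 by move=> t [/andP[]].
have hA : has_sup A by split; [exists 0|exists 1].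
have s0 : 0 <= sup A by apply: ub_le_sup => //; exists 1.
have s1 : sup A <= 1 by apply: ge_sup => //; exists 0.
have [|d d0 [h1 h2]] := Ploc (sup A); first by rewrite s0 s1.
have [x Ax xs] := sup_adherent d0 hA.
have xs' : x <= sup A by apply: ub_le_sup => //; exists 1.
case: Ax => x01 P0x.
have Ps : P 0 (sup A).
  apply: (Padd _ x) => //; first by case/andP: x01.
  by apply: h1 => //; case/andP: x01.
have [s1'|] := ltP (sup A) 1; last first.
  by move=> h; have <- : sup A = 1 by lra.
pose y := Num.min 1 (sup A + d / 2).
have y1 : y <= 1 by rewrite /y ge_min lexx.
have sy : sup A < y by rewrite /y lt_min; apply/andP; split; lra.
have yd : y < sup A + d by rewrite /y gt_min; apply/orP; right; lra.
have : A y.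
  split; first by lra.
  apply: (Padd _ (sup A)) => //; first exact: ltW.
  by apply: h2 => //; exact: ltW.
move=> Ay; have : y <= sup A by apply: ub_le_sup => //; exists 1.
lra.
Qed.

End RealLine.

(** * Moduli and directions in the plane *)

Section Modulus.
Variable R : realType.
Implicit Types (z w u : plane R) (b : bool).

(** The boolean lets one argument serve both foliations: leaves are level sets of [coord b] of the
    half power, with [b] false for the stable foliation and true for the unstable one. *)
Definition coord b : plane R -> R := if b then fst else snd.

Definition modulus z : R := Num.sqrt (z.1 ^+ 2 + z.2 ^+ 2).

Lemma modulus_ge0 z : 0 <= modulus z. Proof. exact: sqrtr_ge0. Qed.

Lemma modulus0 : modulus 0 = 0.
Proof. by rewrite /modulus /= expr0n/= addr0 sqrtr0. Qed.

Lemma sqr_modulus z : modulus z ^+ 2 = z.1 ^+ 2 + z.2 ^+ 2.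
Proof. by rewrite sqr_sqrtr// addr_ge0// sqr_ge0. Qed.

Lemma modulus_eq0 z : modulus z = 0 -> z = 0.
Proof.
move=> z0; have := sqr_modulus z; rewrite z0 expr0n/= => /esym/eqP.
rewrite paddr_eq0 ?sqr_ge0// !sqrf_eq0.
by case: z {z0} => x y /= /andP[/eqP -> /eqP ->].
Qed.

Lemma continuous_modulus : continuous modulus.
Proof.
move=> z; apply: (@continuous_comp _ _ _ (fun z : plane R => z.1 ^+ 2 + z.2 ^+
  2)
  (@Num.sqrt R)); last exact: sqrt_continuous.
apply: cvgD; apply: (@continuous_comp _ _ _ _ (fun x : R => x ^+ 2));
  [exact: cvg_fst|exact: exprn_continuous|exact: cvg_snd|exact:
    exprn_continuous].
Qed.

Lemma cplx_inj : injective (@cplx R).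
Proof. by move=> [a b] [c d] [/= -> ->]. Qed.

Lemma cplx_scale (c : R) u : cplx (c * u.1, c * u.2) = (c%:C)%C * cplx u.
Proof. by rewrite /cplx; simpc. Qed.

Lemma normc_exp (x : R[i]) k : Normc.normc (x ^+ k) = Normc.normc x ^+ k.
Proof.
elim: k => [|k IH]; first by rewrite !expr0 Normc.normc1.
by rewrite !exprS Normc.normcM IH.
Qed.

Lemma normc_sign b (y : R) : 0 <= y -> Normc.normc (((-1) ^+ b * y)%:C)%C = y.
Proof.
by move=> y0; rewrite /= expr0n/= addr0 exprMn sqrr_sign mul1r sqrtr_sqr
  ger0_norm.
Qed.

Lemma modulus_pow b z k (y : R) : 0 <= y ->
  cplx z ^+ k = (((-1) ^+ b * y)%:C)%C -> modulus z ^+ k = y.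
Proof.
move=> y0 zy; have := normc_exp (cplx z) k.
by rewrite zy normc_sign// => ->.
Qed.

Lemma coord_square b w : coord b w = 0 ->
  cplx w ^+ 2 = (((-1) ^+ b * coord (~~ b) w ^+ 2)%:C)%C.
Proof.
case: b; case: w => x y /= ->; rewrite /cplx expr2; simpc.
- by rewrite /= expr2.
- by rewrite /= expr2.
Qed.

Definition axis b (y : R) : plane R := if b then (0, y) else (y, 0).

Lemma coord_axis b y : coord b (axis b y) = 0. Proof. by case: b. Qed.
Lemma coordN_axis b y : coord (~~ b) (axis b y) = y. Proof. by case: b. Qed.

(** On the ray of direction [u] the power [z ^ k] is real of sign [(-1) ^ b], so its square roots
    lie on a coordinate axis. This supplies the explicit half powers with which transverse measures
    are computed. *)
Lemma ray_power b k u (c y : R) : cplx u ^+ k = (((-1) ^+ b)%:C)%C ->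
  y ^+ 2 = c ^+ k -> cplx (axis b y) ^+ 2 = cplx (c * u.1, c * u.2) ^+ k.
Proof.
move=> uk yc; rewrite (@coord_square b) ?coord_axis// coordN_axis yc.
by rewrite cplx_scale exprMn uk -rmorphXn -rmorphM mulrC.
Qed.

Lemma power_roots (a : R[i]) k : (0 < k)%N ->
  exists r : seq R[i], forall x, x ^+ k = a -> x \in r.
Proof.
move=> k0; have [r Er] := closed_field_poly_normal ('X^k - a%:P).
exists r => x xa; rewrite -root_prod_XsubC.
have : root ('X^k - a%:P) x by rewrite rootE !hornerE xa subrr.
rewrite Er (monicP _) ?scale1r// monicE lead_coefDl ?lead_coefXn//.
by rewrite size_polyXn size_polyN (leq_ltn_trans (size_polyC_leq1 _)).
Qed.

Lemma finite_directions b k : (0 < k)%N ->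
  finite_set [set u : plane R | cplx u ^+ k = (((-1) ^+ b)%:C)%C].
Proof.
move=> k0; have [r hr] := power_roots (((-1) ^+ b)%:C)%C k0.
have fr : finite_set [set` r] by exact: finite_seq.
apply: (@sub_finite_set _ _ (@cplx R @^-1` [set` r])); last first.
  by apply: finite_preimage => // x y _ _; exact: cplx_inj.
by move=> u /= /hr.
Qed.

End Modulus.

(** * Arcs in a leaf chart *)

Section Prongs.
Variables (R : realType) (S : topologicalType).
Implicit Types (U : set S) (phi : S -> plane R) (L : S -> set S)
  (gamma : R -> S) (s t : R) (u : plane R) (b : bool).

Definition leafwise_arc L gamma : Prop :=
  [/\ continuous gamma,
      forall s t, 0 <= s <= 1 -> 0 <= t <= 1 -> gamma s = gamma t -> s = t &
      forall s t, L (gamma s) (gamma t)].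

(** The chart image runs outwards along one prong, the ray of direction [u]; the modulus then serves
    as a parameter of the arc. *)
Definition pronged phi gamma u : Prop :=
  [/\ forall t, 0 <= t <= 1 -> {for t, continuous (phi \o gamma)},
      modulus (phi (gamma 0)) = 0,
      forall t, 0 <= t <= 1 ->
        phi (gamma t) = (modulus (phi (gamma t)) * u.1,
                         modulus (phi (gamma t)) * u.2) &
      forall s t, 0 <= s -> s < t -> t <= 1 ->
        modulus (phi (gamma s)) < modulus (phi (gamma t))].

Lemma chart_continuous U phi gamma t : chart U phi -> continuous gamma ->
  U (gamma t) -> {for t, continuous (phi \o gamma)}.
Proof.
move=> [oU cphi _ _] cg Ut; apply: continuous_comp; first exact: cg.
by move: cphi; rewrite continuous_open_subspace// => /(_ (gamma t)); apply;
  rewrite inE.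
Qed.

Lemma chart_inj U phi x y : chart U phi -> U x -> U y -> phi x = phi y -> x = y.
Proof. by move=> [_ _ inj _] Ux Uy; apply: inj; rewrite inE. Qed.

(* The leaf chart gives [phi ^ k = +- y ^ 2] with [y] real along the arc, so the
   direction of [phi] is a root of [+- 1]; being continuous it is constant. *)
Lemma arc_pronged b L k p U phi gamma : (0 < k)%N ->
  leaf_chart (coord b) L k p U phi -> leafwise_arc L gamma -> gamma 0 = p ->
  (forall t, 0 <= t <= 1 -> U (gamma t)) ->
  exists2 u : plane R, cplx u ^+ k = (((-1) ^+ b)%:C)%C & pronged phi gamma u.
Proof.
move=> k0 [cU Up phip lc] [cg ig lg] g0 Ug.
have cphi t : 0 <= t <= 1 -> {for t, continuous (phi \o gamma)}.
  by move=> t01; apply: chart_continuous cU cg _; exact: Ug.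
pose m := @modulus R \o (phi \o gamma).
have cm t : 0 <= t <= 1 -> {for t, continuous m}.
  by move=> /cphi ct; apply: continuous_comp => //; exact: continuous_modulus.
have m0 : m 0 = 0 by rewrite /m /= g0 phip modulus0.
have [w [[_ wz] hw]] : exists w, half_power k (phi \o gamma) w 0 1 /\
    forall t, 0 <= t <= 1 -> coord b (w t) = coord b (w 0).
  by apply/lc => //; exact: continuous_subspaceT.
have w0 : coord b (w 0) = 0.
  have := wz 0; rewrite lexx ler01 /= g0 phip => /(_ isT).
  have -> : cplx (0 : plane R) = 0 by [].
  rewrite expr0n (gtn_eqF k0) => /eqP; rewrite expf_eq0/= => /eqP.
  by case: b {hw lc}; case: (w 0) => x y [-> ->].
pose y t := coord (~~ b) (w t).
have zy t : 0 <= t <= 1 ->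
    cplx (phi (gamma t)) ^+ k = (((-1) ^+ b * y t ^+ 2)%:C)%C.
  by move=> t01; rewrite -(wz t t01) (@coord_square _ b)// hw.
have mk t : 0 <= t <= 1 -> m t ^+ k = y t ^+ 2.
  by move=> t01; apply: (@modulus_pow _ b); [exact: sqr_ge0|exact: zy].
have mpos t : 0 < t <= 1 -> 0 < m t.
  move=> t01; rewrite lt_neqAle modulus_ge0 andbT eq_sym; apply/eqP.
  move=> /modulus_eq0 /= zt; have : t = 0.
    apply: ig; [lra|lra|rewrite g0].
    by apply: (chart_inj cU) => //; [apply: Ug; lra|rewrite zt phip].
  lra.
pose d t : plane R := ((m t)^-1 * (phi (gamma t)).1, (m t)^-1 * (phi (gamma
  t)).2).
have dk t : 0 < t <= 1 -> cplx (d t) ^+ k = (((-1) ^+ b)%:C)%C.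
  move=> t01; have mt := mpos t t01.
  rewrite cplx_scale exprMn zy; last by lra.
  rewrite -rmorphXn -rmorphM exprVn mk; last by lra.
  rewrite mulrCA mulVf ?mulr1// -mk; last by lra.
  by rewrite expf_neq0// gt_eqF.
have cd1 t : 0 < t <= 1 -> {for t, continuous (fun t => (d t).1)}.
  move=> t01; apply: continuousM.
    by apply: continuousV; [rewrite gt_eqF// mpos|apply: cm; lra].
  apply: (@continuous_comp _ _ _ (phi \o gamma)); [apply: cphi;
    lra|exact: cvg_fst].
have cd2 t : 0 < t <= 1 -> {for t, continuous (fun t => (d t).2)}.
  move=> t01; apply: continuousM.
    by apply: continuousV; [rewrite gt_eqF// mpos|apply: cm; lra].
  apply: (@continuous_comp _ _ _ (phi \o gamma)); [apply: cphi;
    lra|exact: cvg_snd].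
have [r hr] := power_roots (((-1) ^+ b)%:C : R[i])%C k0.
have dr1 t : 0 < t <= 1 -> (d t).1 \in map (@complex.Re R) r.
  by move=> t01; apply/mapP; exists (cplx (d t)) => //; exact/hr/dk.
have dr2 t : 0 < t <= 1 -> (d t).2 \in map (@complex.Im R) r.
  by move=> t01; apply/mapP; exists (cplx (d t)) => //; exact/hr/dk.
have one01 : 0 < (1 : R) <= 1 by rewrite ltr01 lexx.
have dE t : 0 < t <= 1 -> d t = d 1.
  move=> t01; apply/pair_equal_spec; split.
    exact: (continuous_finite_constant cd1 dr1 t01 one01).
  exact: (continuous_finite_constant cd2 dr2 t01 one01).
have zE t : 0 <= t <= 1 -> phi (gamma t) = (m t * (d 1).1, m t * (d 1).2).
  move=> t01; have [t0|t0] := eqVneq t 0.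
    by rewrite t0 m0 !mul0r g0 phip.
  have t01' : 0 < t <= 1 by rewrite lt_neqAle eq_sym t0.
  rewrite -(dE t t01') /d/= !mulVKf ?gt_eqF ?mpos//.
  by case: (phi (gamma t)).
exists (d 1); first exact: dk.
split => // s t s0 st t1.
apply: (@injective_increasing _ m 0 1) => //; last by rewrite m0 modulus_ge0.
  exact: continuous_within_itv.
move=> x x' hx hx' mxx; apply: ig => //; apply: (chart_inj cU); try exact: Ug.
by rewrite zE// zE// mxx.
Qed.

Lemma pronged_modulus_le phi gamma u s t : pronged phi gamma u ->
  0 <= s -> s <= t -> t <= 1 -> modulus (phi (gamma s)) <= modulus (phi (gamma
    t)).
Proof.
move=> [_ _ _ h] s0; rewrite le_eqVlt => /orP[/eqP -> //|st] t1.
by apply: ltW; exact: h.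
Qed.

Lemma pronged_modulus_continuous phi gamma u : pronged phi gamma u ->
  {within `[0, 1], continuous (@modulus R \o (phi \o gamma))}.
Proof.
move=> [h _ _ _]; apply: continuous_within_itv => t /h ct.
by apply: continuous_comp => //; exact: continuous_modulus.
Qed.

(** By the intermediate value theorem [eta] attains the modulus of [phi x], and on a common ray the
    modulus determines the point. *)
Lemma same_prong U phi gamma eta u x : chart U phi ->
  pronged phi gamma u -> pronged phi eta u ->
  (forall t, 0 <= t <= 1 -> U (eta t)) ->
  U x -> phi x = (modulus (phi x) * u.1, modulus (phi x) * u.2) ->
  modulus (phi x) <= modulus (phi (eta 1)) ->
  exists2 t : R, 0 <= t <= 1 & x = eta t.
Proof.
move=> cU pg pe Ue Ux phix mx; have [_ e0 he _] := pe.
have [||t t01 /= mt] := IVT_le _ (pronged_modulus_continuous pe) (v := modulus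
  (phi x)).
- exact: ler01.
- by rewrite /= e0 modulus_ge0 mx.
exists t => //; apply: (chart_inj cU) => //; first exact: Ue.
by rewrite phix he// mt.
Qed.

End Prongs.

(** * Turning a regular chart by multiples of a right angle *)

Section QuarterTurn.
Variables (R : realType) (S : topologicalType).
Implicit Types (U : set S) (phi : S -> plane R) (L : S -> set S)
  (gamma : R -> S) (z : plane R) (b e : bool).

(** Multiplication by the sign [(-1) ^ e], and also by the imaginary unit when [b] holds. Up to that
    sign it moves [coord b] to the second place, since [transverse_arc] wants a horizontal chart
    with increasing second coordinate. *)
Definition turn b e z : plane R :=
  if b then (- ((-1) ^+ e * z.2), (-1) ^+ e * z.1)
  else ((-1) ^+ e * z.1, (-1) ^+ e * z.2).

Definition unturn b e z : plane R :=
  if b then ((-1) ^+ e * z.2, - ((-1) ^+ e * z.1))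
  else ((-1) ^+ e * z.1, (-1) ^+ e * z.2).

Lemma turnK b e : cancel (turn b e) (unturn b e).
Proof. by case: b => -[x y]; rewrite /turn /unturn/= ?mulrN ?opprK !signrMK.
  Qed.

Lemma unturnK b e : cancel (unturn b e) (turn b e).
Proof. by case: b => -[x y]; rewrite /turn /unturn/= ?mulrN ?opprK !signrMK.
  Qed.

Lemma snd_turn b e z : (turn b e z).2 = (-1) ^+ e * coord b z.
Proof. by case: b. Qed.

Lemma coord_unturn b e z : coord b (unturn b e z) = (-1) ^+ e * z.2.
Proof. by case: b. Qed.

Lemma cplx_turn b e z : cplx (turn b e z) ^+ 2 = (((-1) ^+ b)%:C)%C * cplx z
  ^+ 2.
Proof.
case: z => x y; case: b; case: e;
  rewrite /turn/cplx/= ?expr0 ?expr1 !expr2; simpc; congr Complex; ring.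
Qed.

Lemma cplx_unturn b e z :
  cplx (unturn b e z) ^+ 2 = (((-1) ^+ b)%:C)%C * cplx z ^+ 2.
Proof.
case: z => x y; case: b; case: e;
  rewrite /unturn/cplx/= ?expr0 ?expr1 !expr2; simpc; congr Complex; ring.
Qed.

Lemma continuous_plane (T : topologicalType) (f g : T -> R) (x : T) :
  {for x, continuous f} -> {for x, continuous g} ->
  {for x, continuous (fun y => (f y, g y) : plane R)}.
Proof. by move=> cf cg; have h := cvg_pair cf cg; exact: h. Qed.

Lemma continuous_scale (a : R) (f : plane R -> R) :
  continuous f -> continuous (fun z => a * f z).
Proof. by move=> cf z; apply: cvgM; [exact: cvg_cst|exact: cf]. Qed.

Lemma continuous_turn b e : continuous (turn b e).
Proof.
have c1 : continuous (fun z => (-1) ^+ e * z.1).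
  by apply: continuous_scale => z; exact: cvg_fst.
have c2 : continuous (fun z => (-1) ^+ e * z.2).
  by apply: continuous_scale => z; exact: cvg_snd.
case: b => z; first exact: (continuous_plane (continuousN (c2 z)) (c1 z)).
exact: (continuous_plane (c1 z) (c2 z)).
Qed.

Lemma continuous_unturn b e : continuous (unturn b e).
Proof.
have c1 : continuous (fun z => (-1) ^+ e * z.1).
  by apply: continuous_scale => z; exact: cvg_fst.
have c2 : continuous (fun z => (-1) ^+ e * z.2).
  by apply: continuous_scale => z; exact: cvg_snd.
case: b => z; first exact: (continuous_plane (c2 z) (continuousN (c1 z))).
exact: (continuous_plane (c1 z) (c2 z)).
Qed.

Lemma within_comp (X Y Z : topologicalType) (A : set X) (g : Y -> Z) (w : X ->
  Y) :
  continuous g -> {within A, continuous w} -> {within A, continuous (g \o w)}.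
Proof.
rewrite !subspace_continuousP => cg cw x Ax.
by apply: (cvg_comp _ _ (cw x Ax)); exact: cg.
Qed.

(** Turning [z] and [w] by the same map multiplies both squares by [(-1) ^ b], so half powers
    correspond to half powers; this is where [k = 2] enters. *)
Lemma leaf_chart_turn b e L p U phi : leaf_chart (coord b) L 2 p U phi ->
  leaf_chart snd L 2 p U (turn b e \o phi).
Proof.
move=> [[oU cphi iphi ophi] Up phip lc]; split.
- split=> //.
  + by apply: within_comp => //; exact: continuous_turn.
  + move=> x y xU yU /= /(can_inj (turnK b e)); exact: iphi.
  + move=> V oV VU.
    have -> : (turn b e \o phi) @` V = unturn b e @^-1` (phi @` V).
      apply/seteqP; split => [z [x Vx <-]|z [x Vx xz]] /=.
        by exists x => //; rewrite turnK.
      by exists x => //=; rewrite xz unturnK.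
    by apply: open_comp; [move=> z _; exact: continuous_unturn|exact: ophi].
- by [].
- by rewrite /= phip /turn; case: b {lc}; rewrite /= !mulr0 ?oppr0.
move=> gamma cg Ug; rewrite (lc gamma cg Ug); split => -[w [[cw wz] hw]].
  exists (turn b e \o w); split; last by move=> t t01; rewrite /= !snd_turn hw.
  split; first by apply: within_comp => //; exact: continuous_turn.
  by move=> t t01; rewrite /= !cplx_turn wz.
exists (unturn b e \o w); split; last first.
  by move=> t t01; rewrite /= !coord_unturn hw.
split; first by apply: within_comp => //; exact: continuous_unturn.
by move=> t t01; rewrite /= cplx_unturn wz//= cplx_turn mulrA -rmorphM -expr2
  sqrr_sign mul1r.
Qed.

End QuarterTurn.

(** * Arcs of one foliation are transverse to the other *)

Section Crossing.
Variables (R : realType) (S : topologicalType) (b : bool) (F G : foliation R S).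
Implicit Types (U : set S) (phi : S -> plane R) (alpha gamma : R -> S)
  (s t a c d x y : R) (u : plane R).

(** [G] is the foliation whose leaves contain the arcs, and [F] the one whose transverse measure is
    evaluated on them. The stable and unstable foliations are used in both roles. *)
Definition crossing_chart k p U phi : Prop :=
  [/\ (0 < k)%N, sing G p <-> k <> 2%N, sing F p <-> k <> 2%N,
      measured_chart (coord b) G k p U phi &
      measured_chart (coord (~~ b)) F k p U phi].

Definition crossing : Prop :=
  forall p, exists k U phi, crossing_chart k p U phi.

Lemma arc_affine L gamma t d : leafwise_arc L gamma -> 0 <= t <= 1 -> 0 <= t +
  d <= 1 ->
  d != 0 -> leafwise_arc L (fun s => gamma (t + d * s)).
Proof.
move=> [cg ig lg] t01 td d0; split => //.
  move=> s; apply: (@continuous_comp _ _ _ (fun s : R => t + d * s));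
    last exact: cg.
  by apply: cvgD; [exact: cvg_cst|apply: cvgM; [exact: cvg_cst|exact: cvg_id]].
move=> s s' hs hs' /ig e; apply: (mulfI d0); apply: (addrI t); apply: e; nra.
Qed.

Lemma arc_stays U gamma t : continuous gamma -> open U -> U (gamma t) ->
  exists2 e : R, 0 < e & forall s, `|s - t| < e -> U (gamma s).
Proof.
move=> cg oU Ut; have /cg : nbhs (gamma t) U by exact: open_nbhs_nbhs.
by move=> /nbhs_ballP[e /= e0 h]; exists e => // s st; apply: h;
  rewrite /ball/= distrC.
Qed.

(** The substitution [t + d * s], with [d] of either sign, turns each side of [gamma t] into an arc
    issuing from the centre of the chart, to which [arc_pronged] applies. *)
Lemma arc_side k U phi gamma t : crossing_chart k (gamma t) U phi ->
  leafwise_arc (leaf G) gamma -> 0 <= t <= 1 ->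
  exists2 e : R, 0 < e & forall d, d != 0 -> `|d| < e -> 0 <= t + d <= 1 ->
    (forall s, 0 <= s <= 1 -> U (gamma (t + d * s))) /\
    exists2 u : plane R, cplx u ^+ k = (((-1) ^+ b)%:C)%C &
      pronged phi (fun s => gamma (t + d * s)) u.
Proof.
move=> [k0 _ _ [lc _] _] ag t01; have [cg _ _] := ag.
have [[oU _ _ _] Ut _ _] := lc.
have [e e0 he] := arc_stays cg oU Ut; exists e => // d d0 de td.
have Ug s : 0 <= s <= 1 -> U (gamma (t + d * s)).
  move=> /andP[s0 s1]; apply: he; rewrite addrC addKr normrM.
  by apply: le_lt_trans de; rewrite ger_pMr ?normr_gt0// ger0_norm.
split => //; apply: (arc_pronged k0 lc) => //; first exact: arc_affine.
by rewrite mulr0 addr0.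
Qed.

Lemma direction2 (u : plane R) : cplx u ^+ 2 = (((-1) ^+ b)%:C)%C ->
  exists e : bool, u = axis b ((-1) ^+ e).
Proof.
case: u => x y; rewrite /cplx expr2; simpc => -[].
rewrite /axis; case: b => /= h1 h2.
  have : x * y = 0 by lra.
  move=> /eqP; rewrite mulf_eq0 => /orP[/eqP x0|/eqP y0]; last by nra.
  have : y ^+ 2 = 1 by nra.
  move=> /eqP; rewrite sqrf_eq1 => /orP[]/eqP ->.
    by exists false; rewrite x0.
  by exists true; rewrite x0.
have : x * y = 0 by lra.
move=> /eqP; rewrite mulf_eq0 => /orP[/eqP x0|/eqP y0]; first by nra.
have : x ^+ 2 = 1 by nra.
move=> /eqP; rewrite sqrf_eq1 => /orP[]/eqP ->.
  by exists false; rewrite y0.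
by exists true; rewrite y0.
Qed.

(** If both sides followed one ray, [same_prong] would put the end nearer to the centre on the other
    side as well, against injectivity. *)
Lemma opposite_sides k U phi gamma t d u u' : crossing_chart k (gamma t) U phi
  ->
  leafwise_arc (leaf G) gamma -> 0 < d -> 0 <= t - d -> t + d <= 1 ->
  (forall s, 0 <= s <= 1 -> U (gamma (t + d * s))) ->
  (forall s, 0 <= s <= 1 -> U (gamma (t + - d * s))) ->
  pronged phi (fun s => gamma (t + d * s)) u ->
  pronged phi (fun s => gamma (t + - d * s)) u' -> u <> u'.
Proof.
move=> [_ _ _ [lc _] _] [_ ig _] d0 td0 td1 Ug Ug' pg pg' uu; subst u'.
have [cU _ _ _] := lc; have one01 : 0 <= (1 : R) <= 1 by rewrite ler01 lexx.
have [_ _ h _] := pg; have [_ _ h' _] := pg'.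
have [le|/ltW le] := leP (modulus (phi (gamma (t + d * 1))))
                         (modulus (phi (gamma (t + - d * 1)))).
  have [//|s s01 /ig e] := same_prong cU pg pg' Ug' (Ug _ one01) (h _ one01) _.
  have := e _ _; nra.
have [//|s s01 /ig e] := same_prong cU pg' pg Ug (Ug' _ one01) (h' _ one01) _.
have := e _ _; nra.
Qed.

(** At a regular point [k = 2] leaves only two directions, so the two sides of the arc follow
    opposite half axes. Hence [coord (~~ b)] is plus or minus the modulus, with opposite signs on
    the two sides, and is strictly monotone through the point. *)
Lemma regular_transverse gamma a c : crossing -> leafwise_arc (leaf G) gamma ->
  (forall t, 0 < t < 1 -> ~ sing G (gamma t)) -> 0 < a -> c < 1 ->
  transverse_arc F gamma a c.
Proof.
move=> cr ag reg a0 c1; have [cg ig lg] := ag.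
split; first exact: continuous_subspaceT.
move=> t /andP[at_ tc]; have t01 : 0 < t < 1 by lra.
have [k [U [phi cc]]] := cr (gamma t); have [k0 kG kF _ [lcF _]] := cc.
have k2 : k = 2%N by apply: contrapT; move/kG; exact: reg.
split; first by move/kF; rewrite k2.
subst k.
have [|e e0 he] := arc_side cc ag (t := t); first by lra.
pose d := Num.min (e / 2) (Num.min t (1 - t)).
have d0 : 0 < d by rewrite !lt_min; apply/and3P; split; lra.
have de : d < e by rewrite gt_min; apply/orP; left; lra.
have dt : d <= t by rewrite !ge_min lexx !orbT.
have dt' : d <= 1 - t by rewrite !ge_min lexx !orbT.
have [|||Ur [u /direction2[i Eu] pu]] := he d; [lra|rewrite gtr0_norm//|lra|].
have [|||Ul [u' /direction2[i' Eu'] pu']] := he (- d).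
- lra.
- by rewrite normrN gtr0_norm.
- lra.
have uu : u <> u' by apply: (opposite_sides cc ag d0 _ _ Ur Ul pu pu'); lra.
have ii : i' = ~~ i by move: uu; rewrite Eu Eu'; case: i {Eu}; case: i' {Eu'}.
have right s : t <= s -> s < t + d -> coord (~~ b) (phi (gamma s)) =
      (-1) ^+ i * modulus (phi (gamma s)).
  move=> ts sd; have [_ _ h _] := pu; have := h ((s - t) / d).
  have -> : t + d * ((s - t) / d) = s by field; lra.
  rewrite divr_ge0//= ?ler_pdivrMr ?mul1r; [|lra|lra|lra].
  have -> : s - t <= d by lra.
  by move=> /(_ isT) {1}->; rewrite Eu /axis; case: b; rewrite /= mulrC.
have left s : t - d < s -> s <= t -> coord (~~ b) (phi (gamma s)) =
      - ((-1) ^+ i * modulus (phi (gamma s))).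
  move=> ts sd; have [_ _ h _] := pu'; have := h ((t - s) / d).
  have -> : t + - d * ((t - s) / d) = s by field; lra.
  rewrite divr_ge0//= ?ler_pdivrMr ?mul1r; [|lra|lra|lra].
  have -> : t - s <= d by lra.
  move=> /(_ isT) {1}->; rewrite Eu' ii /axis.
  by case: b; rewrite /= signrN mulrN mulrC.
have incr s s' : t <= s -> s < s' -> s' < t + d ->
    modulus (phi (gamma s)) < modulus (phi (gamma s')).
  move=> ts ss sd; have [_ _ _ h] := pu.
  have := h ((s - t) / d) ((s' - t) / d).
  have -> : t + d * ((s - t) / d) = s by field; lra.
  have -> : t + d * ((s' - t) / d) = s' by field; lra.
  apply; first by rewrite divr_ge0//; lra.
    by rewrite ltr_pM2r ?invr_gt0//; lra.
  by rewrite ler_pdivrMr// mul1r; lra.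
have decr s s' : t - d < s -> s < s' -> s' <= t ->
    modulus (phi (gamma s')) < modulus (phi (gamma s)).
  move=> ts ss sd; have [_ _ _ h] := pu'.
  have := h ((t - s') / d) ((t - s) / d).
  have -> : t + - d * ((t - s) / d) = s by field; lra.
  have -> : t + - d * ((t - s') / d) = s' by field; lra.
  apply; first by rewrite divr_ge0//; lra.
    by rewrite ltr_pM2r ?invr_gt0//; lra.
  by rewrite ler_pdivrMr// mul1r; lra.
clear he cr cg ig lg reg kF kG pu pu' Eu Eu' uu.
(* The turn by [~~ b] makes the leaves of [F] horizontal, and the sign [i] makes the crossing go
   upwards. *)
exists U, (turn (~~ b) i \o phi), d; split => //.
  exact: leaf_chart_turn.
move=> s s' sac s'ac; rewrite !ltr_norml => sd s'd.
have Us : U (gamma s).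
  have [ts|st] := leP t s.
    have -> : s = t + d * ((s - t) / d) by field; lra.
    by apply: Ur; rewrite divr_ge0 ?ler_pdivrMr//; lra.
  have -> : s = t + - d * ((t - s) / d) by field; lra.
  by apply: Ul; rewrite divr_ge0 ?ler_pdivrMr//; lra.
split => // ss; rewrite /= !snd_turn.
have sgn (x : R) : (-1) ^+ i * ((-1) ^+ i * x) = x by rewrite signrMK.
have [ts|st] := leP t s.
  by rewrite !right ?sgn; [apply: incr; lra|lra|lra|lra|lra].
have [ts'|s't] := leP t s'; last first.
  by rewrite !left ?mulrN ?sgn ?ltrN2; [apply: decr; lra|lra|lra|lra|lra].
rewrite left ?right ?mulrN ?sgn; [|lra|lra|lra|lra].
have := decr s t; have := modulus_ge0 (phi (gamma s')).
have := modulus_ge0 (phi (gamma t)); lra.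
Qed.

End Crossing.

(** * Finiteness of the transverse measure along an arc *)

Section Expansion.
Variables (R : realType) (S : topologicalType) (b : bool) (F G : foliation R S).
Implicit Types (U : set S) (phi : S -> plane R) (alpha gamma : R -> S)
  (tau : R -> R) (s t a c d x y : R) (u : plane R).

Definition additive_measure : Prop :=
  forall alpha x y z, x <= y -> y <= z -> transverse_arc F alpha x z ->
    tmeas F alpha x z = tmeas F alpha x y + tmeas F alpha y z.

Lemma sub_transverse_arc alpha x x' y' y : x <= x' -> y' <= y ->
  transverse_arc F alpha x y -> transverse_arc F alpha x' y'.
Proof.
move=> xx yy [ca h]; split.
  apply: continuous_subspaceW ca => s /=.
  by rewrite !in_itv/=; lra.
move=> t txy; have [|ns [U [phi [e [lc e0 he]]]]] := h t; first by lra.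
split => //; exists U, phi, e; split => // s s' hs hs'.
by apply: he; lra.
Qed.

Lemma signed_sqrt_le (e : bool) (r r' : R) k : 0 <= r -> 0 <= r' ->
  (if e then r' <= r else r <= r') ->
  (-1) ^+ e * Num.sqrt (r ^+ k) <= (-1) ^+ e * Num.sqrt (r' ^+ k).
Proof.
move=> r0 r0'; case: e => /= rr; rewrite ?expr0 ?expr1 ?mulN1r ?mul1r ?lerN2;
  by rewrite ler_wsqrtr// lerXn2r.
Qed.

Lemma continuous_axis (y : R -> R) s : {for s, continuous y} ->
  {for s, continuous (axis b \o y)}.
Proof.
move=> cy; have c0 : {for s, continuous (fun=> 0 : R)} by exact: cst_continuous.
by case: b; [exact: (continuous_plane c0 cy)|exact: (continuous_plane cy c0)].
Qed.

(** The half power along [alpha] is explicit: it stays on one axis, at signed distance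
    [|z| ^ (k / 2)]. The sign [e] records whether [alpha] runs outwards or back to the centre, so
    that the coordinate is nondecreasing as [measured_chart] requires. *)
Lemma tmeas_prong k p U phi gamma u alpha tau (e : bool) a c :
  measured_chart (coord (~~ b)) F k p U phi ->
  cplx u ^+ k = (((-1) ^+ b)%:C)%C -> pronged phi gamma u ->
  (forall s, 0 <= s <= 1 -> U (gamma s)) ->
  continuous alpha -> a <= c -> transverse_arc F alpha a c ->
  (forall s, a <= s <= c -> 0 <= tau s <= 1 /\ alpha s = gamma (tau s)) ->
  (forall s t, a <= s -> s <= t -> t <= c ->
    if e then tau t <= tau s else tau s <= tau t) ->
  tmeas F alpha a c =
    (-1) ^+ e * Num.sqrt (modulus (phi (alpha c)) ^+ k) -
    (-1) ^+ e * Num.sqrt (modulus (phi (alpha a)) ^+ k).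
Proof.
move=> [[cU _ _ _] mc] uk pg Ug ca ac ta htau mon.
pose y s := (-1) ^+ e * Num.sqrt (modulus (phi (alpha s)) ^+ k).
have Ua s : a <= s <= c -> U (alpha s).
  by move=> /htau[t01 ->]; exact: Ug.
have cy s : a <= s <= c -> {for s, continuous y}.
  move=> sac; apply: continuousM; first exact: cst_continuous.
  apply: (@continuous_comp _ _ _ (fun s => modulus (phi (alpha s)) ^+ k));
    last exact: sqrt_continuous.
  apply: (@continuous_comp _ _ _ (fun s => modulus (phi (alpha s))) (fun r : R
    => r ^+ k));
    last exact: exprn_continuous.
  apply: (@continuous_comp _ _ _ (phi \o alpha));
    last exact: continuous_modulus.
  by apply: chart_continuous cU ca _; exact: Ua.
have := mc alpha (axis b \o y) a c ac ta Ua.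
rewrite /= !coordN_axis; apply.
  split.
    by apply: continuous_within_itv => s /cy; exact: continuous_axis.
  move=> s sac /=; have [t01 es] := htau s sac; have [_ _ h _] := pg.
  rewrite [in RHS]es h// -es; apply: ray_power => //.
  by rewrite exprMn sqrr_sign mul1r sqr_sqrtr// exprn_ge0// modulus_ge0.
move=> s t as_ st tc; rewrite /= !coordN_axis.
apply: signed_sqrt_le; rewrite ?modulus_ge0//.
have [s01 ->] : 0 <= tau s <= 1 /\ alpha s = gamma (tau s) by apply: htau; lra.
have [t01 ->] : 0 <= tau t <= 1 /\ alpha t = gamma (tau t) by apply: htau; lra.
have := mon s t as_ st tc.
by case: e {y cy mon} => h; apply: (pronged_modulus_le pg) => //; lra.
Qed.

(* [gamma] may run through singularities, where [tmeas] says nothing about it;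
   only the transverse paths [alpha] that follow it are measured. *)
Definition tame gamma x y : Prop :=
  exists2 C : R, 0 <= C & forall alpha tau a c, a <= c -> continuous alpha ->
    {within `[a, c], continuous tau} ->
    (forall s t, a <= s -> s <= t -> t <= c -> tau s <= tau t) ->
    (forall s, a <= s <= c -> x <= tau s <= y /\ alpha s = gamma (tau s)) ->
    transverse_arc F alpha a c -> tmeas F alpha a c <= C.

Lemma sub_tame gamma x x' y' y : x <= x' -> y' <= y ->
  tame gamma x y -> tame gamma x' y'.
Proof.
move=> xx yy [C C0 h]; exists C => // alpha tau a c ac ca ct mt htau ta.
apply: (h _ tau) => // s sac; have [t01 ->] := htau s sac; split => //; lra.
Qed.

Lemma tame_trans gamma x y z : additive_measure ->
  tame gamma x y -> tame gamma y z -> tame gamma x z.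
Proof.
move=> add [C C0 h] [D D0 h']; exists (C + D); first exact: addr_ge0.
move=> alpha tau a c ac ca ct mt htau ta.
have [cy|yc] := leP (tau c) y.
  apply: (@le_trans _ _ C); last by rewrite lerDl.
  apply: (h _ tau) => // s sac; have [t01 ->] := htau s sac.
  by split => //; have := mt s c; lra.
have [ya|ay] := leP y (tau a).
  apply: (@le_trans _ _ D); last by rewrite lerDr.
  apply: (h' _ tau) => // s sac; have [t01 ->] := htau s sac.
  by split => //; have := mt a s; lra.
(* The path is cut at a parameter where it passes the point of parameter [y]. *)
have [|m mac my] := IVT_le ac ct (v := y); first by lra.
rewrite (add alpha a m c) //; [|lra|lra].
have sub x' y' : a <= x' -> y' <= c -> {within `[x', y'], continuous tau}.
  move=> ax yc'; apply: continuous_subspaceW ct => s /=.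
  by rewrite !in_itv/=; lra.
apply: lerD.
  apply: (h _ tau) => //; [lra|apply: sub; lra| | |].
  - by move=> s t as_ st tm; apply: mt; lra.
  - move=> s sam; have [|t01 ->] := htau s; first by lra.
    by split => //; have := mt s m; lra.
  - by apply: sub_transverse_arc ta; lra.
apply: (h' _ tau) => //; [lra|apply: sub; lra| | |].
- by move=> s t as_ st tm; apply: mt; lra.
- move=> s sam; have [|t01 ->] := htau s; first by lra.
  by split => //; have := mt m s; lra.
- by apply: sub_transverse_arc ta; lra.
Qed.

(** On each side of each parameter the arc follows a prong, at a singular point too. There
    [tmeas_prong] gives the measure as a difference of values of [|z| ^ (k / 2)], at most the value
    at the far end. [cousin] adds up the local bounds. *)
Lemma arc_tame gamma : crossing b F G -> additive_measure ->
  leafwise_arc (leaf G) gamma -> tame gamma 0 1.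
Proof.
move=> cr add ag; apply: cousin => [x y z _ _ _ _|t t01].
  exact: tame_trans.
have [k [U [phi cc]]] := cr (gamma t).
have [e e0 he] := arc_side cc ag t01.
have [_ _ _ _ mF] := cc.
have pos y : t < y -> y < t + e -> y <= 1 -> tame gamma t y.
  move=> ty yt y1; have [|||Ug [u uk pg]] := he (y - t);
    [lra|by rewrite gtr0_norm; lra|lra|].
  exists (Num.sqrt (modulus (phi (gamma (t + (y - t) * 1))) ^+ k)).
    exact: sqrtr_ge0.
  move=> alpha tau a c ac ca ct mt htau ta.
  have htau' s : a <= s <= c -> 0 <= (tau s - t) / (y - t) <= 1 /\
      alpha s = gamma (t + (y - t) * ((tau s - t) / (y - t))).
    move=> sac; have [tt ->] := htau s sac; split; last by congr gamma; field;
      lra.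
    by rewrite divr_ge0 ?ler_pdivrMr ?mul1r; lra.
  rewrite (@tmeas_prong k _ U phi _ u alpha _ false a c mF uk pg Ug ca ac ta
    htau').
    rewrite expr0 !mul1r lerBlDr -[leLHS]addr0 lerD ?sqrtr_ge0//.
    rewrite ler_wsqrtr// lerXn2r ?nnegrE ?modulus_ge0//.
    have [|h ->] := htau' c; first by lra.
    by apply: (pronged_modulus_le pg); lra.
  move=> s s' as_ ss s'c; rewrite ler_pM2r ?invr_gt0; last by lra.
  by rewrite lerB// mt.
have neg x : t - e < x -> x < t -> 0 <= x -> tame gamma x t.
  move=> tx xt x0; have [|||Ug [u uk pg]] := he (x - t);
    [lra|by rewrite ltr0_norm; lra|lra|].
  exists (Num.sqrt (modulus (phi (gamma (t + (x - t) * 1))) ^+ k)).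
    exact: sqrtr_ge0.
  move=> alpha tau a c ac ca ct mt htau ta.
  have htau' s : a <= s <= c -> 0 <= (t - tau s) / (t - x) <= 1 /\
      alpha s = gamma (t + (x - t) * ((t - tau s) / (t - x))).
    move=> sac; have [tt ->] := htau s sac; split; last by congr gamma; field;
      lra.
    by rewrite divr_ge0 ?ler_pdivrMr ?mul1r; lra.
  rewrite (@tmeas_prong k _ U phi _ u alpha _ true a c mF uk pg Ug ca ac ta
    htau').
    rewrite expr1 !mulN1r opprK addrC lerBlDr -[leLHS]addr0 lerD ?sqrtr_ge0//.
    rewrite ler_wsqrtr// lerXn2r ?nnegrE ?modulus_ge0//.
    have [|h ->] := htau' a; first by lra.
    by apply: (pronged_modulus_le pg); lra.
  move=> s s' as_ ss s'c; rewrite ler_pM2r ?invr_gt0; last by lra.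
  by rewrite lerB// mt.
(* [cousin] also asks for the degenerate interval, which is contained in a one-sided one. *)
have tt : tame gamma t t.
  have [t1|t1] := ltP t 1.
    pose y := Num.min 1 (t + e / 2).
    have ty : t < y by rewrite lt_min; apply/andP; split; lra.
    apply: (@sub_tame _ t t t y) => //; first exact: ltW.
    apply: pos => //; last by rewrite ge_min lexx.
    by rewrite gt_min; apply/orP; right; lra.
  pose x := Num.max 0 (t - e / 2).
  have xt : x < t by rewrite gt_max; apply/andP; split; lra.
  apply: (@sub_tame _ x t t t) => //; first exact: ltW.
  apply: neg => //; last by rewrite le_max lexx.
  by rewrite lt_max; apply/orP; right; lra.
exists e => //; split => [x x0 tx|y y1].
  by rewrite le_eqVlt => /orP[/eqP ->//|xt]; apply: neg; lra.
by rewrite le_eqVlt => /orP[/eqP <-//|ty] yt; apply: pos.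
Qed.

(** A short piece issuing from the midpoint has measure [|z| ^ (k / 2)] at its far end, which is
    positive. It avoids the ends of the arc, which may be singular. *)
Lemma arc_measure_pos gamma : crossing b F G -> leafwise_arc (leaf G) gamma ->
  (forall t, 0 < t < 1 -> ~ sing G (gamma t)) ->
  exists a c, [/\ 0 < a, a <= c, c < 1 & 0 < tmeas F gamma a c].
Proof.
move=> cr ag reg; have [cg _ _] := ag.
pose t : R := 1 / 2.
have [k [U [phi cc]]] := cr (gamma t).
have [|e e0 he] := arc_side cc ag (t := t); first by rewrite /t; lra.
pose d := Num.min (e / 2) (1 / 4).
have d0 : 0 < d by rewrite lt_min; apply/andP; split; lra.
have de : d < e by rewrite gt_min; apply/orP; left; lra.
have d4 : d <= 1 / 4 by rewrite ge_min lexx orbT.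
have [|||Ug [u uk pg]] := he d; [lra|by rewrite gtr0_norm|rewrite /t; lra|].
have [k0 _ _ _ mF] := cc.
exists t, (t + d); split; [rewrite /t; lra|lra|rewrite /t; lra|].
have := @tmeas_prong k _ U phi _ u gamma (fun s => (s - t) / d) false t (t +
  d) mF uk pg Ug cg.
move=> ->; last 1 first.
- by move=> s s' ts ss sd; rewrite ler_pM2r ?invr_gt0// lerB.
- have [_ _ _ h] := pg; have [_ m0 _ _] := pg; move: m0.
  rewrite mulr0 addr0 => ->; rewrite expr0n (gtn_eqF k0) sqrtr0 mulr0 subr0.
  rewrite expr0 mul1r sqrtr_gt0 exprn_gt0//.
  have := h 0 1; rewrite mulr0 mulr1 addr0 => h1.
  by apply: (le_lt_trans (modulus_ge0 (phi (gamma t)))); apply: h1; lra.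
- lra.
- by apply: (regular_transverse cr ag reg); rewrite /t; lra.
move=> s std; split; last by congr gamma; field; lra.
by rewrite divr_ge0 ?ler_pdivrMr; lra.
Qed.

End Expansion.

(** * Nested arcs *)

Section Nesting.
Variables (R : realType) (S : topologicalType) (b : bool) (F G : foliation R S).
Implicit Types (U : set S) (phi : S -> plane R) (alpha gamma eta : R -> S)
  (tau : R -> R) (s t a c d x y : R) (u : plane R).

Definition runs_inside gamma eta : Prop :=
  forall t, 0 <= t <= 1 -> exists2 s : R, 0 <= s <= 1 & gamma t = eta s.

Definition germ_inside gamma eta : Prop :=
  exists2 e : R, 0 < e <= 1 &
    forall t, 0 <= t <= e -> exists2 s : R, 0 <= s <= 1 & gamma t = eta s.

(** An injective path on a compact interval is a homeomorphism onto its image in a Hausdorff space.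
    Concretely, the image [K] of the parameters at distance at least [e] from [tau s0] is closed and
    misses [gamma s0], so it misses [gamma s] for [s] near [s0]. *)
Lemma runs_inside_lift L gamma eta : hausdorff_space S -> continuous gamma ->
  leafwise_arc L eta -> runs_inside gamma eta ->
  exists2 tau : R -> R, {within `[0, 1], continuous tau} &
    forall s, 0 <= s <= 1 -> 0 <= tau s <= 1 /\ gamma s = eta (tau s).
Proof.
move=> hS cg [ce ie _] h.
have /choice[tau htau] : forall s, exists t, 0 <= s <= 1 ->
    0 <= t <= 1 /\ gamma s = eta t.
  move=> s; have [/h[t t01 e]|_] := boolP (0 <= s <= 1); first by exists t.
  by exists 0.
exists tau => //; apply/within_itvP => s0 s01.
have [t01 gt0] := htau s0 s01.
apply/cvgrPdist_lt => e e0; rewrite near_withinE.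
pose K := eta @` ([set` `[0, tau s0 - e]] `|` [set` `[tau s0 + e, 1]]).
have cK : closed K.
  apply: compact_closed => //; apply: continuous_compact.
    exact: continuous_subspaceT.
  by apply: compactU; exact: segment_compact.
have nK : nbhs (gamma s0) (~` K).
  apply: open_nbhs_nbhs; split; first exact: closed_openC.
  rewrite gt0 => -[t]; rewrite /= !in_itv/= => ht /ie et.
  by have := et _ _; lra.
have nK' : nbhs s0 [set s | ~ K (gamma s)] by exact: (cg s0 _ nK).
apply: filterS nK' => s nKs; rewrite /= in_itv/= => hs; rewrite ltNge;
  apply/negP => le.
have [ts es] := htau s hs.
apply: nKs; rewrite /= es; exists (tau s) => //=; rewrite !in_itv/=.
by move: le; rewrite ler_normr; lra.
Qed.

(** The lift inherits injectivity from [gamma] and starts at 0, its least possible value; being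
    continuous, it increases. *)
Lemma lift_increasing L gamma eta tau : leafwise_arc L gamma -> leafwise_arc L
  eta ->
  gamma 0 = eta 0 -> {within `[0, 1], continuous tau} ->
  (forall s, 0 <= s <= 1 -> 0 <= tau s <= 1 /\ gamma s = eta (tau s)) ->
  tau 0 = 0 /\ forall s t, 0 <= s -> s < t -> t <= 1 -> tau s < tau t.
Proof.
move=> [cg ig _] [ce ie _] g0 ct htau.
have z01 : 0 <= (0 : R) <= 1 by rewrite lexx ler01.
have t0 : tau 0 = 0.
  by have [t01 e] := htau 0 z01; apply: ie => //; rewrite -e.
split => //; apply: injective_increasing => //.
  move=> s t hs ht st; apply: ig => //.
  by rewrite (htau s hs).2 (htau t ht).2 st.
have [|+ _] := htau 1; first by rewrite ler01 lexx.
by rewrite t0; case/andP.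
Qed.

(** If [gamma] reaches further than [eta] along the ray, it is stopped where its modulus equals that
    of the end of [eta]; what remains is covered by [same_prong]. *)
Lemma prong_germ U phi gamma eta u : chart U phi ->
  pronged phi gamma u -> pronged phi eta u ->
  (forall t, 0 <= t <= 1 -> U (gamma t)) ->
  (forall t, 0 <= t <= 1 -> U (eta t)) -> germ_inside gamma eta.
Proof.
move=> cU pg pe Ug Ue; have [_ g0 hg ig] := pg; have [_ e0 he ie] := pe.
suff [e e01 he'] : exists2 e : R, 0 < e <= 1 &
    modulus (phi (gamma e)) <= modulus (phi (eta 1)).
  exists e => // t te; have t01 : 0 <= t <= 1 by lra.
  have := same_prong cU pg pe Ue (Ug t t01) (hg t t01); apply.
  by apply: le_trans he'; apply: (pronged_modulus_le pg); lra.
have [le|lt] := leP (modulus (phi (gamma 1))) (modulus (phi (eta 1))).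
  by exists 1 => //; rewrite ltr01 lexx.
have mpos : 0 < modulus (phi (eta 1)) by rewrite -e0; apply: ie.
have [||e e01 /= ee] := IVT_le _ (pronged_modulus_continuous pg) (v := modulus
  (phi (eta 1))).
- exact: ler01.
- by rewrite /= g0 modulus_ge0 ltW.
exists e; last by rewrite ee.
rewrite lt_neqAle; case/andP: e01 => -> ->; rewrite !andbT eq_sym.
by apply/eqP => e1; move: ee mpos; rewrite e1 g0 => ->; rewrite ltxx.
Qed.

Definition regular_inside gamma := forall t, 0 < t < 1 -> ~ sing G (gamma t).

(** Only two directions leave a regular point, and the two sides of [eta] occupy both. The forward
    side of [gamma] therefore follows one of them. *)
Lemma regular_germ gamma eta t (r : R) : crossing b F G ->
  leafwise_arc (leaf G) gamma -> leafwise_arc (leaf G) eta ->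
  0 < t < 1 -> 0 < r < 1 -> gamma t = eta r -> ~ sing G (gamma t) ->
  exists2 d : R, 0 < d <= 1 - t & forall s, t <= s <= t + d ->
    exists2 s' : R, 0 <= s' <= 1 & gamma s = eta s'.
Proof.
move=> cr ag ae t01 r01 e ns.
have [k [U [phi cc]]] := cr (gamma t); have [_ kG _ [[cU _ _ _] _] _] := cc.
have k2 : k = 2%N by apply: contrapT; move/kG.
subst k.
have cc' : crossing_chart b F G 2 (eta r) U phi by rewrite -e.
have [|e1 e10 h1] := arc_side cc ag (t := t); first by lra.
have [|e2 e20 h2] := arc_side cc' ae (t := r); first by lra.
pose d := Num.min (e1 / 2) (1 - t).
have d0 : 0 < d by rewrite lt_min; apply/andP; split; lra.
have de : d < e1 by rewrite gt_min; apply/orP; left; lra.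
have dt : d <= 1 - t by rewrite ge_min lexx orbT.
pose d' := Num.min (e2 / 2) (Num.min r (1 - r)).
have d'0 : 0 < d' by rewrite !lt_min; apply/and3P; split; lra.
have d'e : d' < e2 by rewrite gt_min; apply/orP; left; lra.
have d'r : d' <= r by rewrite !ge_min lexx !orbT.
have d'r' : d' <= 1 - r by rewrite !ge_min lexx !orbT.
have [|||Ug [u /direction2[i Eu] pu]] := h1 d; [lra|by rewrite gtr0_norm|lra|].
have [|||Ur [v /direction2[j Ev] pv]] := h2 d'; [lra|by rewrite gtr0_norm|lra|].
have [|||Ul [v' /direction2[j' Ev'] pv']] := h2 (- d').
- lra.
- by rewrite normrN gtr0_norm.
- lra.
have vv : v <> v' by apply: (opposite_sides cc' ae d'0 _ _ Ur Ul pv pv'); lra.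
have [q q01 hq] : exists2 q : R, 0 < q <= 1 & forall s, 0 <= s <= q ->
    exists2 s' : R, 0 <= s' <= 1 & gamma (t + d * s) = eta s'.
  have [uv|uv'] : u = v \/ u = v'.
    move: vv; rewrite Eu Ev Ev'.
    by case: i {Eu}; case: j {Ev}; case: j' {Ev'} => // _; by [left|right].
  - rewrite -uv in pv; have [q q01 hq] := prong_germ cU pu pv Ug Ur.
    exists q => // s /hq[s' s01 es]; exists (r + d' * s') => //; nra.
  - rewrite -uv' in pv'; have [q q01 hq] := prong_germ cU pu pv' Ug Ul.
    exists q => // s /hq[s' s01 es]; exists (r + - d' * s') => //; nra.
exists (d * q); first by nra.
move=> s hs; have -> : s = t + d * ((s - t) / d) by field; lra.
by apply: hq; rewrite divr_ge0 ?ler_pdivrMr 1?mulrC//; lra.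
Qed.

Lemma longest_inside (I : set S) gamma (e : R) : closed I -> continuous gamma ->
  0 < e <= 1 -> (forall s, 0 <= s <= e -> I (gamma s)) ->
  exists T : R, [/\ e <= T, T <= 1, forall s, 0 <= s <= T -> I (gamma s) &
    forall T' : R, 0 <= T' <= 1 -> (forall s, 0 <= s <= T' -> I (gamma s)) ->
      T' <= T].
Proof.
move=> cI cg /andP[e0 e1] Ie.
pose X := [set t : R | 0 <= t <= 1 /\ forall s, 0 <= s <= t -> I (gamma s)].
have Xe : X e by split => //; rewrite e1 ltW.
have uX : ubound X 1 by move=> t [/andP[]].
have sX : has_sup X by split; [exists e|exists 1].
have eT : e <= sup X by apply: ub_le_sup => //; exists 1.
have T1 : sup X <= 1 by apply: ge_sup => //; exists e.
have Tmax (T' : R) : 0 <= T' <= 1 -> (forall s, 0 <= s <= T' -> I (gamma s)) ->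
    T' <= sup X by move=> h h'; apply: ub_le_sup => //; exists 1.
have Xlt s : 0 <= s -> s < sup X -> I (gamma s).
  move=> s0 sT; have [|x [x01 Xx] xs] := @sup_adherent _ X (sup X - s) _ sX.
    by rewrite subr_gt0.
  by apply: Xx; rewrite s0 ltW//; move: xs; rewrite subKr.
exists (sup X); split => //.
move: (sup X) eT {T1 Tmax} Xlt => T eT Xlt.
move=> s /andP[s0]; rewrite le_eqVlt => /orP[/eqP ->|]; last exact: Xlt.
(* A value outside the closed set at [T] would force values outside it shortly before [T]. *)
apply: contrapT => nI.
have [d d0 hd] := arc_stays cg (closed_openC cI) nI.
pose m := Num.min (d / 2) T.
have m0 : 0 < m by rewrite lt_min; apply/andP; split; lra.
have mT : m <= T by rewrite ge_min lexx orbT.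
have md : m < d by rewrite gt_min; apply/orP; left; lra.
apply: (hd (T - m)); last by apply: Xlt; lra.
by rewrite addrAC subrr add0r normrN gtr0_norm.
Qed.

(** Consider the longest initial piece of [gamma], up to [T], contained in [eta]. Unless one arc is
    exhausted at [T], both are there at an interior point, regular by hypothesis on [gamma], and
    [regular_germ] prolongs the piece. *)
Lemma arcs_nested gamma eta : hausdorff_space S -> crossing b F G ->
  leafwise_arc (leaf G) gamma -> leafwise_arc (leaf G) eta ->
  regular_inside gamma -> gamma 0 = eta 0 -> germ_inside gamma eta ->
  runs_inside gamma eta \/ runs_inside eta gamma.
Proof.
move=> hS cr ag ae rg g0 [e e01 he].
have [cg ig lg] := ag; have [ce ie _] := ae.
pose I := eta @` `[0, 1].
have II x : I (gamma x) <-> exists2 s : R, 0 <= s <= 1 & gamma x = eta s.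
  by split => -[s]; rewrite /= ?in_itv/= => s01 es; exists s.
have cI : closed I.
  apply: compact_closed => //; apply: continuous_compact.
    exact: continuous_subspaceT.
  exact: segment_compact.
have [|T [eT T1 XT Tmax]] := longest_inside cI cg e01.
  by move=> s /he /II.
have T0 : 0 < T by apply: lt_le_trans eT; case/andP: e01.
have [T1'|T1'] := ltP T 1; last first.
  by left => t /andP[t0 t1]; apply/II/XT; rewrite t0 (le_trans t1).
right; have aT : leafwise_arc (leaf G) (fun s => gamma (0 + T * s)).
  by apply: (@arc_affine _ _ _ gamma 0 T);
    rewrite ?add0r ?gt_eqF// ?lexx ?ler01// T1 ltW.
have [||tau ct htau] := @runs_inside_lift _ (fun s => gamma (0 + T * s)) eta
  hS _ ae.
- by case: aT.
- move=> t /andP[t0 t1]; apply/II/XT.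
  by rewrite add0r mulr_ge0// ?ler_piMr// ltW.
have [t0 inc] : tau 0 = 0 /\ forall s t, 0 <= s -> s < t -> t <= 1 -> tau s <
  tau t.
  by apply: (lift_increasing aT ae) => //; rewrite mulr0 addr0.
have [|t101 et1] := htau 1; first by rewrite ler01 lexx.
have gT : gamma T = eta (tau 1) by rewrite -et1 mulr1 add0r.
(* If the lift of the piece reaches 1, it runs through all parameters of [eta], so [eta] lies inside
   [gamma]. *)
have [t1|t1] := ltP (tau 1) 1; last first.
  move=> v /andP[v0 v1]; have [||s s01 es] := IVT_le _ ct (v := v).
  - exact: ler01.
  - by rewrite t0 v0 (le_trans v1).
  exists (0 + T * s); last by rewrite (htau s s01).2 es.
  by case/andP: s01 => s0 s1; rewrite add0r mulr_ge0 ?(ltW T0)//= mulr_ile1//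
    ltW.
exfalso; have t10 : 0 < tau 1 by rewrite -t0; apply: inc; rewrite ?ltr01.
have [|||d /andP[d0 dT] hd] := regular_germ cr ag ae _ _ gT.
- by rewrite T0 T1'.
- by rewrite t10 t1.
- by apply: rg; rewrite T0 T1'.
have : T + d <= T.
  apply: Tmax; first by rewrite addr_ge0 ?(ltW T0) ?(ltW d0)//= -lerBrDl.
  move=> s /andP[s0 sT]; have [sT'|Ts] := leP s T; first by apply: XT;
    rewrite s0.
  by apply/II/hd; rewrite ltW.
by rewrite gerDl leNgt d0.
Qed.

End Nesting.

(** * Expansion along the leaves *)

Section Dynamics.
Variables (R : realType) (S : topologicalType) (b : bool) (F G : foliation R S).
Variables (g : S -> S) (lambda : R) (Sg : set S).
Hypotheses (hS : hausdorff_space S) (crFG : crossing b F G)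
  (addF : additive_measure F) (finSg : finite_set Sg)
  (finG : finite_set (sing G)).
Implicit Types (gamma eta : R -> S) (n m : nat).

(** Common form of the two uses, the homeomorphism on unstable arcs and its inverse on stable arcs.
    Scaling is asked only for arcs with regular interior and away from their ends, where they are
    transverse to [F]. *)
Definition expanding : Prop :=
  [/\ continuous g, injective g,
      forall x y, leaf G x y -> leaf G (g x) (g y),
      forall x, sing G (g x) <-> sing G x &
      1 < lambda /\ forall gamma a c, leafwise_arc (leaf G) gamma ->
        regular_inside G gamma -> 0 < a -> a <= c -> c < 1 ->
        tmeas F (g \o gamma) a c = lambda * tmeas F gamma a c].

Hypotheses (exg : expanding) (gSg : forall x, Sg x -> Sg (g x)).

Lemma leafwise_arc_iter n gamma : leafwise_arc (leaf G) gamma ->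
  leafwise_arc (leaf G) (iter n g \o gamma).
Proof.
have [cg ig lg _ _] := exg; move=> ag; elim: n => [//|n [c i l]].
split; first by move=> x; apply: (@continuous_comp _ _ _ (iter n g \o gamma)
  g); [exact: c|exact: cg].
  by move=> s t hs ht /= /ig; exact: i.
by move=> s t; apply: lg; exact: l.
Qed.

Lemma regular_inside_iter n gamma : regular_inside G gamma ->
  regular_inside G (iter n g \o gamma).
Proof.
have [_ _ _ sg _] := exg; move=> r; elim: n => [//|n IH] t t01 /= /sg.
exact: IH.
Qed.

Lemma iter_Sg n x : Sg x -> Sg (iter n g x).
Proof. by move=> Sx; elim: n => [//|n IH]; exact: gSg. Qed.

Lemma iter_sing n x : sing G x -> sing G (iter n g x).
Proof. by have [_ _ _ sg _] := exg; move=> Sx; elim: n => [//|n IH];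
  apply/sg. Qed.

Lemma tmeas_iter n gamma a c : leafwise_arc (leaf G) gamma ->
  regular_inside G gamma -> 0 < a -> a <= c -> c < 1 ->
  tmeas F (iter n g \o gamma) a c = lambda ^+ n * tmeas F gamma a c.
Proof.
have [_ _ _ _ [_ h]] := exg; move=> ag rg a0 ac c1.
elim: n => [|n IH]; first by rewrite expr0 mul1r.
rewrite exprS -mulrA -IH -h//; first exact: leafwise_arc_iter.
exact: regular_inside_iter.
Qed.

Lemma bernoulli n : 1 < lambda -> 1 + n%:R * (lambda - 1) <= lambda ^+ n.
Proof.
move=> l1; elim: n => [|n IH]; first by rewrite mul0r addr0 expr0.
rewrite exprS; have n0 : 0 <= n%:R :> R by rewrite ler0n.
apply: (@le_trans _ _ (lambda * (1 + n%:R * (lambda - 1)))).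
  by have := mulr_ge0 n0 (sqr_ge0 (lambda - 1)); rewrite -natr1; nra.
by rewrite ler_pM2l//; lra.
Qed.

Lemma expr_unbounded (c C : R) : 1 < lambda -> 0 < c ->
  exists N, forall n, (N <= n)%N -> C < lambda ^+ n * c.
Proof.
move=> l1 c0; pose M := Num.trunc (`|C| / (c * (lambda - 1))).
exists M.+1 => n Mn.
have d0 : 0 < lambda - 1 by lra.
have h1 : `|C| / (c * (lambda - 1)) < n%:R.
  apply: lt_le_trans (_ : M.+1%:R <= _); last by rewrite ler_nat.
  by apply: truncnS_gt.
have h2 : `|C| < n%:R * (lambda - 1) * c.
  by move: h1; rewrite ltr_pdivrMr ?mulr_gt0// (mulrC c) mulrA.
have h3 : n%:R * (lambda - 1) <= lambda ^+ n.
  by have := bernoulli n l1; lra.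
apply: le_lt_trans (ler_norm C) _; apply: lt_le_trans h2 _.
by rewrite ler_pM2r.
Qed.

(** Some piece of [gamma] has positive measure, which [iter n g] multiplies by [lambda ^ n]. An
    iterate inside [eta] with the same initial point lifts to an increasing parameter, so [arc_tame]
    bounds this measure independently of [n]. *)
Lemma no_confinement gamma eta : leafwise_arc (leaf G) gamma ->
  leafwise_arc (leaf G) eta -> regular_inside G gamma ->
  (forall N, exists n, [/\ (N <= n)%N, iter n g (gamma 0) = eta 0 &
     runs_inside (iter n g \o gamma) eta]) -> False.
Proof.
move=> ag ae rg conf.
have [a [c [a0 ac c1 mpos]]] := arc_measure_pos crFG ag rg.
have [C C0 hC] := arc_tame crFG addF ae.
have [_ _ _ _ [l1 _]] := exg.
have [N hN] := expr_unbounded C l1 mpos.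
have [n [Nn start inside]] := conf N.
have agn := leafwise_arc_iter n ag; have [cgn _ _] := agn.
have [tau ct htau] := runs_inside_lift hS cgn ae inside.
have [t0 inc] := lift_increasing agn ae start ct htau.
have := hN n Nn; rewrite -(tmeas_iter n ag rg a0 ac c1) => /lt_le_trans h.
suff /h : tmeas F (iter n g \o gamma) a c <= C by rewrite ltxx.
apply: (hC _ tau) => //.
- apply: continuous_subspaceW ct => s /=; rewrite !in_itv/= => /andP[as_ sc].
  by rewrite (le_trans (ltW a0))// (le_trans sc)// ltW.
- move=> s t as_; rewrite le_eqVlt => /orP[/eqP -> //|st] tc.
  by apply/ltW/inc => //; [exact: le_trans (ltW a0) as_|exact: le_trans tc
    (ltW c1)].
- move=> s /andP[as_ sc]; apply: htau.
  by rewrite (le_trans (ltW a0))// (le_trans sc)// ltW.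
- by apply: (regular_transverse crFG agn (regular_inside_iter rg)).
Qed.

Lemma pigeonhole (T : Type) (X : set T) (c : nat -> T) : finite_set X ->
  (forall n, X (c n)) -> exists x, forall N, exists2 n, (N <= n)%N & c n = x.
Proof.
move=> fX cX; apply: contrapT => /forallNP h.
have : finite_set [set: nat].
  have -> : [set: nat] = \bigcup_(x in X) [set n | c n = x].
    by apply/seteqP; split => n // _; exists (c n).
  apply: bigcup_finite => // x _; apply: contrapT => inf; apply: (h x) => N.
  apply: contrapT => /forall2NP hN; apply: inf.
  apply: (@sub_finite_set _ _ `I_N); last exact: finite_II.
  by move=> n /= cn; have [/negP|/(_ cn)//] := hN n; rewrite -ltnNge.
exact: infinite_nat.
Qed.

(* A class records the initial point of an arc and the prong it follows. *)
Lemma arc_classes : exists (X : set (S * plane R))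
    (cls : (R -> S) -> S * plane R -> Prop),
  [/\ finite_set X,
      forall gamma, leafwise_arc (leaf G) gamma -> Sg (gamma 0) ->
        exists2 c, X c & cls gamma c &
      forall gamma eta c, cls gamma c -> cls eta c ->
        gamma 0 = eta 0 /\ germ_inside gamma eta].
Proof.
have /choice[ch hch] : forall p, exists kUphi : nat * set S * (S -> plane R),
    crossing_chart b F G kUphi.1.1 p kUphi.1.2 kUphi.2.
  by move=> p; have [k [U [phi cc]]] := crFG p; exists (k, U, phi).
pose D p := [set u : plane R | cplx u ^+ (ch p).1.1 = (((-1) ^+ b)%:C)%C].
pose cls gamma (c : S * plane R) := gamma 0 = c.1 /\
  exists2 d : R, 0 < d <= 1 &
    (forall s, 0 <= s <= 1 -> (ch c.1).1.2 (gamma (0 + d * s))) /\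
    pronged (ch c.1).2 (fun s => gamma (0 + d * s)) c.2.
exists (\bigcup_(p in Sg) [set (p, u) | u in D p]), cls; split.
- apply: bigcup_finite => // p _; apply: finite_image.
  by apply: finite_directions; have [] := hch p.
- move=> gamma ag Sg0.
  have [|e e0 he] := arc_side (hch (gamma 0)) ag (t := 0).
    by rewrite lexx ler01.
  pose d := Num.min (e / 2) 1.
  have d0 : 0 < d by rewrite lt_min ltr01 andbT divr_gt0.
  have de : d < e by rewrite gt_min ltr_pdivrMr// ltr_pMr// ltr1n.
  have d1 : d <= 1 by rewrite ge_min lexx orbT.
  have [|||Ug [u uk pu]] := he d; first by rewrite gt_eqF.
  + by rewrite gtr0_norm.
  + by rewrite add0r d1 ltW.
  exists (gamma 0, u); first by exists (gamma 0) => //; exists u.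
  by split => //; exists d => //; rewrite d0 d1.
- move=> gamma eta [p u] [/= g0 [d d01 [Ug pu]]] [/= e0 [d' d'01 [Ue pu']]].
  split; first by rewrite g0.
  have [_ _ _ [[cU _ _ _] _] _] := hch p.
  have [e e01 he] := prong_germ cU pu pu' Ug Ue.
  exists (d * e); first by nra.
  move=> t td; have [|s s01 es] := he (t / d).
  + by rewrite ler_pdivrMr ?divr_ge0//; lra.
  exists (0 + d' * s); first by nra.
  by rewrite -es add0r mulrC divfK// gt_eqF//; case/andP: d01.
Qed.

(** The lift of [gamma] to the parameters of [eta] is continuous from 0 to 1, hence surjective. *)
Lemma runs_inside_same_endpoints gamma eta : leafwise_arc (leaf G) gamma ->
  leafwise_arc (leaf G) eta -> gamma 0 = eta 0 -> gamma 1 = eta 1 ->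
  runs_inside gamma eta -> runs_inside eta gamma.
Proof.
move=> ag ae g0 g1 inside; have [cg _ _] := ag.
have [tau ct htau] := runs_inside_lift hS cg ae inside.
have [t0 _] := lift_increasing ag ae g0 ct htau.
have one01 : 0 <= (1 : R) <= 1 by rewrite ler01 lexx.
have [t101 e1] := htau 1 one01.
have t1 : tau 1 = 1.
  by have [_ ie _] := ae; apply: ie => //; rewrite -e1.
move=> v v01; have [||s s01 es] := IVT_le _ ct (v := v).
- exact: ler01.
- by rewrite t0 t1.
by exists s => //; rewrite (htau s s01).2 es.
Qed.

(** Infinitely many iterates of the arc fall into one of the finitely many classes. Their singular
    ends make nested arcs of one class coincide, so these iterates all run inside a single arc,
    against [no_confinement]. *)
Lemma no_saddle_connection gamma : leafwise_arc (leaf G) gamma ->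
  Sg (gamma 0) -> regular_inside G gamma -> ~ sing G (gamma 1).
Proof.
move=> ag Sg0 rg s1.
have [X [cls [fX clsX germ]]] := arc_classes.
have agn n := leafwise_arc_iter n ag.
have /choice[c hc] : forall n, exists c, X c /\ cls (iter n g \o gamma) c.
  by move=> n; have [c Xc hc] := clsX _ (agn n) (iter_Sg n Sg0); exists c.
have [x hx] := pigeonhole fX (fun n => (hc n).1).
have [n0 _ cn0] := hx 0.
have h0 := (hc n0).2; rewrite cn0 in h0.
apply: (no_confinement ag (agn n0) rg) => N.
have [n Nn cn] := hx N; exists n.
have hn := (hc n).2; rewrite cn in hn.
have [start germn] := germ _ _ _ hn h0.
split => //.
have [//|inside] := arcs_nested hS crFG (agn n) (agn n0)
  (regular_inside_iter rg) start germn.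
(* If the arc of [n0] lies inside that of [n], its singular end is a point of the latter, which is
   regular inside; by injectivity it is not the common initial point, so it is the other end. *)
apply: runs_inside_same_endpoints => //.
have [|s s01 es] := inside 1; first by rewrite ler01 lexx.
have ss : sing G ((iter n g \o gamma) s) by rewrite -es; exact: iter_sing.
have [s1'|s1'] := eqVneq s 1; first by rewrite es s1'.
have [s0|s0] := eqVneq s 0.
  have [_ i _] := agn n0; have : (1 : R) = 0.
    by apply: i; rewrite ?lexx ?ler01// es s0 -start.
  by move/eqP; rewrite oner_eq0.
exfalso; apply: (regular_inside_iter rg) ss.
by case/andP: s01 => s00 s11; rewrite !lt_neqAle eq_sym s0 s00 s1' s11.
Qed.

(** An injective arc meets the finite set of singularities finitely often; cut at the first meeting
    after its start, it would be a saddle connection. *)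
Lemma regular_arc gamma t : leafwise_arc (leaf G) gamma -> Sg (gamma 0) ->
  0 < t <= 1 -> ~ sing G (gamma t).
Proof.
move=> ag Sg0 t01 st; have [cg ig _] := ag.
pose A := [set s : R | 0 < s <= 1 /\ sing G (gamma s)].
have fA : finite_set A.
  (* [par] recovers the parameter of a singularity on the arc, with default 0, so that [A] is
     contained in the image of a finite set. *)
  have /choice[par hpar] : forall p, exists s : R,
      forall s', A s' -> gamma s' = p -> s = s'.
    move=> p; have [[s [As es]]|np] := pselect (exists s, A s /\ gamma s = p).
      exists s => s' [/andP[/ltW s0' s1'] _] es';
        case: As => /andP[/ltW s0 s1] _.
      by apply: ig; rewrite ?s0 ?s1 ?s0' ?s1'// es es'.
    by exists 0 => s' As es; case: np; exists s'.
  apply: (@sub_finite_set _ _ (par @` sing G)); last exact: finite_image.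
  by move=> s As; exists (gamma s); [case: As|exact: hpar].
have [s [/andP[s0 s1] ss] smin] := finite_set_min fA (conj t01 st : A t).
have as_ : leafwise_arc (leaf G) (fun x => gamma (0 + s * x)).
  by apply: (@arc_affine _ _ _ gamma 0 s);
    rewrite ?add0r ?gt_eqF ?lexx ?ler01// s1 ltW.
apply: (no_saddle_connection as_).
- by rewrite mulr0 addr0.
- move=> x /andP[x0 x1]; rewrite add0r => sx.
  have sxs : s * x < s by rewrite gtr_pMr.
  have : s <= s * x.
    by apply: smin; split => //; rewrite mulr_gt0//= (le_trans (ltW sxs)).
  by rewrite leNgt sxs.
- by rewrite mulr1 add0r.
Qed.

End Dynamics.

(** * Intersections of stable and unstable arcs *)

Section FirstIntersections.
Variables (R : realType) (S : topologicalType).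
Implicit Types (gamma eta : R -> S) (F G : foliation R S) (x y z : S).

Lemma crossing_chart_swap b F G k p U phi :
  crossing_chart b F G k p U phi -> crossing_chart (~~ b) G F k p U phi.
Proof. by case=> ? ? ? ? ?; split; rewrite ?negbK. Qed.

(* Where the two arcs meet near [gamma t], [phi ^ k] is both nonnegative and
   nonpositive. *)
Lemma local_crossing b F G gamma eta (t r : R) : crossing b F G ->
  leafwise_arc (leaf F) gamma -> leafwise_arc (leaf G) eta ->
  0 <= t <= 1 -> 0 <= r <= 1 -> gamma t = eta r ->
  exists2 e : R, 0 < e & forall t' r' : R, `|t' - t| < e -> `|r' - r| < e ->
    0 <= t' <= 1 -> 0 <= r' <= 1 -> gamma t' = eta r' -> gamma t' = gamma t.
Proof.
move=> cr ag ae t01 r01 tr.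
have [k [U [phi cc]]] := cr (gamma t).
have [e1 e10 h1] := arc_side (crossing_chart_swap cc) ag t01.
have [k0 _ _ [[cU Up phip _] _] _] := cc.
rewrite {1}tr in cc; have [e2 e20 h2] := arc_side cc ae r01.
exists (Num.min e1 e2); first by rewrite lt_min e10.
move=> t' r'; rewrite !lt_min => /andP[te1 _] /andP[_ re2] t'01 r'01 e.
have [->//|tt] := eqVneq t' t.
have [rr|rr] := eqVneq r' r; first by rewrite e rr -tr.
have tE : t + (t' - t) = t' by rewrite addrC subrK.
have rE : r + (r' - r) = r' by rewrite addrC subrK.
have [|||Ug [u uk [_ _ hu _]]] := h1 (t' - t); rewrite ?subr_eq0 ?tE//.
have [|||Ue [v vk [_ _ hv _]]] := h2 (r' - r); rewrite ?subr_eq0 ?rE//.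
have one01 : 0 <= (1 : R) <= 1 by rewrite ler01 lexx.
have := hu 1 one01; have := hv 1 one01; have := Ug 1 one01.
rewrite !mulr1 tE rE -e => Ut hv1 hu1.
apply: (chart_inj cU) => //; rewrite phip.
apply: modulus_eq0; set m := modulus _.
have mk : m ^+ k = 0.
  have := congr1 (fun z : plane R => cplx z ^+ k) hu1.
  rewrite {1}hv1 /= !cplx_scale !exprMn uk vk -rmorphXn -!rmorphM => /complexI.
  rewrite -/m; case: (b); rewrite /= ?expr0 ?expr1 ?mulrN !mulr1; lra.
by apply/eqP; move/eqP: mk; rewrite expf_eq0 k0.
Qed.

(** By [cousin] it suffices that near each parameter [t] the only possible common point is
    [gamma t]. Off [eta] this is closedness of its image; on [eta] it is [local_crossing]. *)
Lemma finite_crossing b F G gamma eta : hausdorff_space S -> crossing b F G ->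
  leafwise_arc (leaf F) gamma -> leafwise_arc (leaf G) eta ->
  finite_set (gamma @` `[0, 1] `&` eta @` `[0, 1]).
Proof.
move=> hS cr ag ae; have [cg _ _] := ag; have [ce ie _] := ae.
pose J := eta @` `[0, 1].
have closed_eta (A : set R) : compact A -> closed (eta @` A).
  move=> cA; apply: compact_closed => //; apply: continuous_compact => //.
  exact: continuous_subspaceT.
apply: (@cousin R (fun x y : R => finite_set (gamma @` [set` `[x, y]] `&` J))).
  move=> x y z _ _ _ _ fxy fyz.
  apply: (@sub_finite_set _ _ ((gamma @` [set` `[x, y]] `&` J) `|`
    (gamma @` [set` `[y, z]] `&` J))); last by rewrite finite_setU.
  move=> _ [[t /= txz <-] Jt]; rewrite in_itv/= in txz.
  have [ty|yt] := leP t y; [left|right]; split => //; exists t => //=;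
    by rewrite in_itv/=; case/andP: txz => tx tz; rewrite ?tx ?tz ?ty ?(ltW yt).
move=> t t01.
suff [d d0 hd] : exists2 d : R, 0 < d & forall t' : R, 0 <= t' <= 1 ->
    `|t' - t| < d -> J (gamma t') -> gamma t' = gamma t.
  have sub (A : set R) : (forall t', A t' -> 0 <= t' <= 1 /\ `|t' - t| < d) ->
      finite_set (gamma @` A `&` J).
    move=> hA; apply: (@sub_finite_set _ _ [set gamma t]) => //.
    by move=> _ [[t' At' <-] Jt]; have [t'01 t'd] := hA _ At'; exact: hd.
  exists d => //; split => [x x0 xt xt'|y y1 ty yt]; apply: sub => t';
    rewrite /= in_itv/= ltr_norml => ht'; lra.
have [[r /= r01 er]|nJ] := pselect (J (gamma t)); last first.
  have cJ : closed J by apply: closed_eta; exact: segment_compact.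
  have [e e0 he] := arc_stays cg (closed_openC cJ) nJ.
  by exists e => // t' _ /he nJ' /nJ'.
rewrite in_itv/= in r01.
have [e e0 he] := local_crossing cr ag ae t01 r01 (esym er).
(* [local_crossing] controls only parameters of [eta] near [r]. The others have a closed image [K]
   missing [gamma t], hence missing a neighbourhood of it. *)
pose K := eta @` ([set` `[0, r - e]] `|` [set` `[r + e, 1]]).
have cK : closed K.
  by apply: closed_eta; apply: compactU; exact: segment_compact.
have nK : ~ K (gamma t).
  rewrite -er => -[r']; rewrite /= !in_itv/= => hr' /ie er'.
  by have := er' _ _; lra.
have [d d0 hd] := arc_stays cg (closed_openC cK) nK.
exists (Num.min d e); first by rewrite lt_min d0.
move=> t' t'01; rewrite lt_min => /andP[t'd t'e] [r' /=].
rewrite in_itv/= => r'01 er'; apply: (he _ r') => //.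
have := hd _ t'd; rewrite /= => nK'; rewrite ltNge; apply/negP => le.
apply: nK'; rewrite -er'; exists r' => //=; rewrite !in_itv/=.
by move: le; rewrite ler_normr; lra.
Qed.

Lemma full_orbit_eq (T : Type) (f : T -> T) (x y : T) m n : injective f ->
  iter m f x = iter n f y -> full_orbit f x = full_orbit f y.
Proof.
move=> injf; have inji k : injective (iter k f) by elim: k => [//|k IH]
  u v /= /injf /IH.
(* In this symmetric form, lying in one full orbit means that some forward iterates agree. *)
have orbitE u v : full_orbit f u v <-> exists i j, iter i f u = iter j f v.
  split => [[k [e|e]]|[i [j e]]]; [by exists k, 0%N|by exists 0%N, k|].
  have [ij|ji] := leqP i j.
    exists (j - i)%N; right; apply: (inji i); rewrite -iterD subnKC//.
  exists (i - j)%N; left; apply: (inji j); rewrite -iterD subnKC//; exact: ltnW.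
move=> e; apply/seteqP; split => z; rewrite !orbitE => -[i [j eij]].
  exists (i + n)%N, (m + j)%N; rewrite iterD -e -iterD addnC !iterD eij//.
exists (i + m)%N, (n + j)%N; rewrite iterD e -iterD addnC !iterD eij//.
Qed.

Variables (Fs Fu : foliation R S) (Sg : set S).

(** First intersection points in terms of parametrised arcs. The parameter intervals are open at 0,
    which leaves out the initial points in [Sg]. *)
Definition crossing_arcs x gamma eta : Prop :=
  [/\ ~ Sg x, Sg (gamma 0) /\ Sg (eta 0),
      leafwise_arc (leaf Fs) gamma /\ leafwise_arc (leaf Fu) eta,
      gamma 1 = x /\ eta 1 = x &
      forall s t : R, 0 < s <= 1 -> 0 < t <= 1 -> gamma s = eta t -> gamma s =
        x].

Lemma leaf_arc_clamp F p x I : (forall x, leaf F x x) ->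
  (forall x y, leaf F x y -> leaf F x = leaf F y) ->
  leaf_arc R (leaf F p) p x I ->
  exists2 gamma, leafwise_arc (leaf F) gamma &
    [/\ gamma 0 = p, gamma 1 = x &
        forall t : R, 0 < t <= 1 -> (I `\ p) (gamma t)].
Proof.
move=> lxx lxy [gamma [cg ig [g0 g1] -> sub]].
have z01 : 0 <= (0 : R) <= 1 by rewrite lexx ler01.
have one01 : 0 <= (1 : R) <= 1 by rewrite lexx ler01.
have inj s t : 0 <= s <= 1 -> 0 <= t <= 1 -> gamma s = gamma t -> s = t.
  by move=> hs ht; apply: ig; rewrite inE/= in_itv.
exists (gamma \o @clamp R).
  split; first exact: within_clamp_continuous.
    by move=> s t hs ht; rewrite /= !clamp_id//; exact: inj.
  have lp s : leaf F p ((gamma \o @clamp R) s).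
    by apply: sub; exists (clamp s) => //=; rewrite in_itv/= clamp_itv.
  by move=> s t; rewrite -(lxy _ _ (lp s)).
split; rewrite /= ?clamp_id// => t /andP[t0 t1].
have t01 : 0 <= t <= 1 by rewrite ltW.
rewrite clamp_id//; split; first by exists t => //=; rewrite in_itv.
rewrite /= -g0 => /inj e; move: t0; rewrite e ?ltxx//.
Qed.

Lemma first_intersection_arcs x : measured_foliation Fs -> measured_foliation
  Fu ->
  first_intersection Fs Fu Sg x -> exists gamma eta, crossing_arcs x gamma eta.
Proof.
move=> [[rs ts] _ _ _ _] [[ru tu] _ _ _ _].
move=> [nx [p [q [A [B [I [J [[Sp Sq] _ _ [aI aJ] IJ]]]]]]]].
have [gamma ag [g0 g1 gI]] := leaf_arc_clamp rs ts aI.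
have [eta ae [e0 e1 eJ]] := leaf_arc_clamp ru tu aJ.
exists gamma, eta; split; rewrite ?g0 ?e0 ?g1 ?e1//.
move=> s t /gI Is /eJ Jt e; suff : [set x] (gamma s) by [].
by rewrite -IJ; split => //; rewrite e.
Qed.

Lemma crossing_arcs_map (h : S -> S) x gamma eta : continuous h -> injective h
  ->
  (forall x y, leaf Fs x y -> leaf Fs (h x) (h y)) ->
  (forall x y, leaf Fu x y -> leaf Fu (h x) (h y)) ->
  (forall x, Sg (h x) <-> Sg x) ->
  crossing_arcs x gamma eta -> crossing_arcs (h x) (h \o gamma) (h \o eta).
Proof.
move=> ch ih hs hu hSg [nx [Sp Sq] [[cg ig lg] [ce ie le]] [g1 e1] only]; split.
- by move/hSg.
- by split; apply/hSg.
- split; split.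
  + by move=> t; apply: (@continuous_comp _ _ _ gamma h); [exact: cg|exact: ch].
  + by move=> s t s01 t01 /= /ih; exact: ig.
  + by move=> s t; exact: hs.
  + by move=> t; apply: (@continuous_comp _ _ _ eta h); [exact: ce|exact: ch].
  + by move=> s t s01 t01 /= /ih; exact: ie.
  + by move=> s t; exact: hu.
- by rewrite /= g1 e1.
by move=> s t s01 t01 /= /ih /(only s t s01 t01) ->.
Qed.

End FirstIntersections.

(** * Orbits of first intersection points *)

Section Finiteness.
Variables (R : realType) (S : topologicalType) (f g : S -> S).
Variables (Fs Fu : foliation R S) (Sg : set S) (lambda mu : R).
Hypotheses (hS : hausdorff_space S)
  (crs : crossing false Fu Fs) (cru : crossing true Fs Fu)
  (mFs : measured_foliation Fs) (mFu : measured_foliation Fu)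
  (finSg : finite_set Sg) (fK : cancel f g) (gK : cancel g f)
  (exf : expanding Fs Fu f lambda) (exg : expanding Fu Fs g mu)
  (fleaf : forall x y, leaf Fs x y -> leaf Fs (f x) (f y))
  (gleaf : forall x y, leaf Fu x y -> leaf Fu (g x) (g y))
  (fSg : forall x, Sg (f x) <-> Sg x).

Let gSg x : Sg (g x) <-> Sg x.
Proof. by rewrite -fSg gK. Qed.

Let iterfg n x : iter n f (iter n g x) = x.
Proof. by elim: n x => [//|n IH] x; rewrite iterSr iterS gK IH. Qed.

Lemma crossing_arcs_iterf n x gamma eta : crossing_arcs Fs Fu Sg x gamma eta ->
  crossing_arcs Fs Fu Sg (iter n f x) (iter n f \o gamma) (iter n f \o eta).
Proof.
have [cf injf leaff _ _] := exf; move=> h; elim: n => [//|n IH].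
exact: (crossing_arcs_map cf injf fleaf leaff fSg IH).
Qed.

Lemma crossing_arcs_iterg n x gamma eta : crossing_arcs Fs Fu Sg x gamma eta ->
  crossing_arcs Fs Fu Sg (iter n g x) (iter n g \o gamma) (iter n g \o eta).
Proof.
have [cg injg leafg _ _] := exg; move=> h; elim: n => [//|n IH].
exact: (crossing_arcs_map cg injg leafg gleaf gSg IH).
Qed.

Lemma measured_finite_sing F : measured_foliation F -> finite_set (@sing R S F).
Proof. by case. Qed.

Lemma measured_additive F : measured_foliation F -> @additive_measure R S F.
Proof. by case=> _ _ _ + _; exact. Qed.

(** Stable arcs are expanded by the inverse [g], so the absence of saddle connections is applied to
    [g] here and to [f] for unstable arcs. *)
Lemma regular_stable gamma : leafwise_arc (leaf Fs) gamma -> Sg (gamma 0) ->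
  regular_inside Fs gamma.
Proof.
move=> ag Sg0 t /andP[t0 t1].
apply: (regular_arc hS crs (measured_additive mFu) finSg
  (measured_finite_sing mFs) exg) => //.
  by move=> x /gSg.
by rewrite t0 ltW.
Qed.

Lemma regular_unstable gamma : leafwise_arc (leaf Fu) gamma -> Sg (gamma 0) ->
  regular_inside Fu gamma.
Proof.
move=> ag Sg0 t /andP[t0 t1].
apply: (regular_arc hS cru (measured_additive mFs) finSg
  (measured_finite_sing mFu) exf) => //.
  by move=> x /fSg.
by rewrite t0 ltW.
Qed.

Theorem finite_first_intersection_orbits :
  finite_set [set full_orbit f x | x in [set x |
    first_intersection Fs Fu Sg x]].
Proof.
have [Xs [clss [fXs Xsok germs]]] := arc_classes crs finSg.
have [Xu [clsu [fXu Xuok germu]]] := arc_classes cru finSg.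
have [[x0 _]|none] := pselect (exists x, first_intersection Fs Fu Sg x);
  last first.
  apply: (@sub_finite_set _ _ set0) => // z [x fx _].
  by case: none; exists x.
pose X := Xs `*` Xu.
have fX : finite_set X by exact: finite_setX.
pose good (c : (S * plane R) * (S * plane R)) (r : S * (R -> S) * (R -> S)) :=
  [/\ crossing_arcs Fs Fu Sg r.1.1 r.1.2 r.2, clss r.1.2 c.1 & clsu r.2 c.2].
(* The reference point and arcs of the pair of classes [c], if it carries any. Otherwise the value
   is a constant default built from [x0], and the sets [E] that involve [c] are empty. *)
have /choice[ref href] : forall c, exists r, forall r', good c r' -> good c r.
  move=> c; have [[r gr]|nr] := pselect (exists r, good c r); first by exists r.
  by exists (x0, cst x0, cst x0) => r' gr'; case: nr; exists r'.
pose E c c' := [set z | [/\ good c (ref c), good c' (ref c') &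
  ((ref c').1.2 @` `[0, 1] `&` (f \o (ref c).2) @` `[0, 1]) z]].
have fE c c' : finite_set (E c c').
  have [[gc gc']|n] := pselect (good c (ref c) /\ good c' (ref c')); last first.
    apply: (@sub_finite_set _ _ set0) => // z [gc gc' _].
    by case: n.
  apply: (@sub_finite_set _ _ ((ref c').1.2 @` `[0, 1]
    `&` (f \o (ref c).2) @` `[0, 1])).
    by move=> z [].
  have [[_ _ [_ aeta] _ _] _ _] := gc; have [[_ _ [agamma _] _ _] _ _] := gc'.
  apply: (finite_crossing hS cru agamma).
  exact: (leafwise_arc_iter exf 1 aeta).
have classes x gamma eta : crossing_arcs Fs Fu Sg x gamma eta ->
    exists c, [/\ X c, good c (x, gamma, eta) & good c (ref c)].
  move=> h; have [_ [Sp Sq] [ag ae] _ _] := h.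
  have [cs Xcs hcs] := Xsok _ ag Sp; have [cu Xcu hcu] := Xuok _ ae Sq.
  have gd : good (cs, cu) (x, gamma, eta) by [].
  by exists (cs, cu); split => //; exact: href gd.
have nestu c r r' : good c r -> good c r' ->
    r.2 0 = r'.2 0 /\ (runs_inside r.2 r'.2 \/ runs_inside r'.2 r.2).
  move=> [[_ [_ Sq] [_ ae] _ _] _ cu] [[_ _ [_ ae'] _ _] _ cu'].
  have [e0 ge] := germu _ _ _ cu cu'; split => //.
  by apply: (arcs_nested hS cru ae ae') => //; exact: regular_unstable.
have nests c r r' : good c r -> good c r' ->
    runs_inside r.1.2 r'.1.2 \/ runs_inside r'.1.2 r.1.2.
  move=> [[_ [Sp _] [ag _] _ _] cs _] [[_ _ [ag' _] _ _] cs' _].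
  have [e0 ge] := germs _ _ _ cs cs'.
  by apply: (arcs_nested hS crs ag ag') => //; exact: regular_stable.
have confine r r' : crossing_arcs Fs Fu Sg r.1.1 r.1.2 r.2 ->
    crossing_arcs Fs Fu Sg r'.1.1 r'.1.2 r'.2 ->
    ~ (forall N, exists n, [/\ (N <= n)%N, iter n f (r.2 0) = r'.2 0 &
        runs_inside (iter n f \o r.2) r'.2]).
  move=> [_ [_ Sq] [_ ae] _ _] [_ _ [_ ae'] _ _].
  apply: (no_confinement hS cru (measured_additive mFs) exf ae ae').
  exact: regular_unstable.
apply: (@sub_finite_set _ _
  (full_orbit f @` \bigcup_(c in X) \bigcup_(c' in X) E c c')); last first.
  by apply: finite_image; apply: bigcup_finite => // c _; apply: bigcup_finite.
move=> _ [y /(first_intersection_arcs mFs mFu)[gamma [eta arcs_y]] <-].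
(* far enough in the past, the unstable arc is short *)
have [m [c0 [Xc0 gc0 gr0 short]]] : exists m c,
    [/\ X c, good c (iter m g y, iter m g \o gamma, iter m g \o eta),
        good c (ref c) & runs_inside (iter m g \o eta) (ref c).2].
  apply: contrapT => /forallNP never.
  have /choice[c hc] : forall m, exists c, [/\ X c,
      good c (iter m g y, iter m g \o gamma, iter m g \o eta) & good c (ref c)].
    by move=> m; apply: classes; exact: crossing_arcs_iterg.
  have [x hx] := pigeonhole fX (fun n => let: And3 h _ _ := hc n in h).
  have [n0 _ cn0] := hx 0%N; have [_ _ gx] := hc n0; rewrite cn0 in gx.
  have [ax _ _] := gx.
  apply: (confine _ (y, gamma, eta) ax arcs_y) => N; have [n Nn cn] := hx N.
  have [Xn gn gxn] := hc n; rewrite cn in gn gxn Xn.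
  have [start nested] := nestu _ _ _ gx gn.
  exists n; split => //; first by rewrite start /= iterfg.
  (* As [never] excludes the other inclusion, the reference arc lies inside the past arc, and
     [iter n f] carries it into [eta]. This happens for infinitely many [n], against [confine]. *)
  have inside : runs_inside (ref x).2 (iter n g \o eta).
    by case: nested => // inside; case: (never n); exists x.
  by move=> t /inside[s s01 es]; exists s => //; rewrite /= es /= iterfg.
pose y' := iter m g y; pose gamma' := iter m g \o gamma;
  pose eta' := iter m g \o eta.
have arcs_y' : crossing_arcs Fs Fu Sg y' gamma' eta' by exact:
  crossing_arcs_iterg.
(* At time 0 the class has to be [c0], for which the short inclusion is known; the last clause keeps
   this for the base case of the minimality argument. *)
have /choice[c hc] : forall n, exists c, [/\ X c,
    good c (iter n f y', iter n f \o gamma', iter n f \o eta'), good c (ref c) &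
    n = 0%N -> runs_inside eta' (ref c).2].
  case=> [|n]; first by exists c0.
  have [c [Xc gc gr]] := classes _ _ _ (crossing_arcs_iterf n.+1 arcs_y').
  by exists c.
(* The index is shifted because the two inclusions are wanted at consecutive times, short at [n] and
   long at [n.+1]. *)
pose P n := `[< runs_inside (ref (c n.+1)).2 (iter n.+1 f \o eta') >].
(* in the future it is long *)
have exP : exists n, P n.
  apply: contrapT => /forallNP never.
  have [x hx] := pigeonhole (c := fun n => c n.+1) fX (fun n => let: And4 h _
    _ _ := hc n.+1 in h).
  have [n0 _ cn0] := hx 0%N; have [_ _ gx _] := hc n0.+1; rewrite cn0 in gx.
  have [ax _ _] := gx.
  apply: (confine (y', gamma', eta') _ arcs_y' ax) => N; have [n Nn cn] := hx N.
  have [_ gn _ _] := hc n.+1; rewrite cn in gn.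
  have [start nested] := nestu _ _ _ gn gx.
  exists n.+1; split => //; first exact: leqW.
  by case: nested => // inside; case: (never n); apply/asboolP; rewrite cn.
have [n /asboolP long nmin] := ex_minnP exP.
have [Xn gn grn base] := hc n; have [Xn1 gn1 grn1 _] := hc n.+1.
(* For positive [n], minimality denies the reverse inclusion at time [n], and nesting gives this
   one; at time 0 it is the choice of [y']. *)
have shortn : runs_inside (iter n f \o eta') (ref (c n)).2.
  case: n {long gn1 grn1 Xn1 Xn} nmin gn grn base => [|n] nmin gn grn base.
    exact: base.
  have [_ [//|inside]] := nestu _ _ _ gn grn.
  by have := nmin n; rewrite ltnn; case/(_ _)/negP => //; apply/asboolP.
exists (iter n.+1 f y'); last first.
  apply: (@full_orbit_eq _ f _ _ m n.+1); first exact: can_inj fK.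
  by rewrite -iterD addnC iterD iterfg.
exists (c n) => //; exists (c n.+1) => //; split => //.
have one01 : 0 <= (1 : R) <= 1 by rewrite ler01 lexx.
have [_ _ _ [g1 e1] _] := arcs_y'.
split; last first.
  have [s s01 es] := shortn 1 one01.
  by exists s; rewrite /= ?in_itv//= -es /= e1.
have [[nr _ _ [r1 r1'] _] _ _] := grn1.
have [[_ [Sp Sq] _ [h1 _] only] _ _] := gn1.
have [inside|inside] := nests _ _ _ gn1 grn1.
  have [s s01 es] := inside 1 one01.
  by exists s; rewrite /= ?in_itv//= -es.
(* Here the reference stable arc is the inner one, so the reference point lies on both arcs of the
   orbit point. Being outside [Sg], it is not an initial point, and hence it equals the orbit
   point. *)
have [s s01 es] := long 1 one01; have [t t01 et] := inside 1 one01.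
exists 1; rewrite /= ?in_itv//= et; apply: (only t s).
- rewrite lt_neqAle; case/andP: t01 => -> ->; rewrite !andbT eq_sym.
  by apply/eqP => t0; apply: nr; rewrite -r1 et t0.
- rewrite lt_neqAle; case/andP: s01 => -> ->; rewrite !andbT eq_sym.
  by apply/eqP => s0; apply: nr; rewrite -r1' es s0.
- by rewrite -et r1 -r1' es.
Qed.

End Finiteness.

(** * Pseudo-Anosov homeomorphisms expand unstable arcs, their inverses stable arcs *)

Section PseudoAnosov.
Variables (R : realType) (S : topologicalType).
Implicit Types (f g : S -> S) (F G : foliation R S).

Lemma preserves_sing f F : injective f -> preserves_foliation f F ->
  forall x, sing F (f x) <-> sing F x.
Proof.
move=> injf [_ sf] x; split => [|sx]; last by rewrite -sf; exists x.
by rewrite -{1}sf => -[y sy /injf <-].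
Qed.

Lemma preserves_leaf f F x y : preserves_foliation f F -> leaf F x y ->
  leaf F (f x) (f y).
Proof. by move=> [lf _] lxy; rewrite -lf; exists y. Qed.

Lemma preserves_foliation_inv f g F : cancel f g -> cancel g f ->
  preserves_foliation f F -> preserves_foliation g F.
Proof.
move=> fK gK [lf sf]; split => [x|].
  have := lf (g x); rewrite gK => <-.
  apply/seteqP; split => [z [_ [y ly <-] <-]|z lz]; first by rewrite fK.
  by exists (f z); rewrite ?fK//; exists z.
rewrite -{1}sf; apply/seteqP; split => [z [_ [y ly <-] <-]|z lz].
  by rewrite fK.
by exists (f z); rewrite ?fK//; exists z.
Qed.

Lemma transverse_crossing b F G lambda f : continuous f -> injective f ->
  crossing b F G -> preserves_foliation f G -> 1 < lambda ->
  scales_measure f F lambda -> expanding F G f lambda.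
Proof.
move=> cf injf cr pf l1 sc; split => //.
- by move=> x y; exact: preserves_leaf.
- exact: preserves_sing.
split => // gamma a c ag rg a0 ac c1; apply: sc => //.
exact: (regular_transverse cr ag rg a0 c1).
Qed.

(** The scaling of [f] by [lambda^-1] is applied to [g \o gamma], which [f] brings back to [gamma].
    This arc is transverse since [g] preserves the leaves and the singularities of [G]. *)
Lemma inverse_expanding b F G lambda f g : continuous g -> cancel f g ->
  cancel g f -> crossing b F G -> preserves_foliation f G -> 1 < lambda ->
  scales_measure f F lambda^-1 -> expanding F G g lambda.
Proof.
move=> cg fK gK cr pf l1 sc.
have pg := preserves_foliation_inv fK gK pf; have injg := can_inj gK.
split => //.
- by move=> x y; exact: preserves_leaf.
- exact: preserves_sing.
split => // gamma a c [c_ i l] rg a0 ac c1.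
have ag' : leafwise_arc (leaf G) (g \o gamma).
  split; first by move=> t; apply: (@continuous_comp _ _ _ gamma g);
    [exact: c_|exact: cg].
    by move=> s t hs ht /= /injg; exact: i.
  by move=> s t; exact: preserves_leaf.
have rg' : regular_inside G (g \o gamma).
  by move=> t t01 /= /(preserves_sing injg pg); exact: rg.
have := sc (g \o gamma) a c ac (regular_transverse cr ag' rg' a0 c1).
have -> : f \o (g \o gamma) = gamma by apply/funext => t /=; rewrite gK.
by move=> ->; rewrite mulrA divff ?mul1r// gt_eqF// (lt_trans ltr01).
Qed.

End PseudoAnosov.

Theorem proposition3 (R : realType) (S : topologicalType)
    (atl : set (set S * (S -> plane R))) (f : S -> S)
    (Fs Fu : foliation R S) (Sg : set S) :
  closed_oriented_surface atl ->
  generalized_pseudo_Anosov atl f Fs Fu ->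
  singular_family f Fs Sg ->
  finite_set [set full_orbit f x | x in [set x |
    first_intersection Fs Fu Sg x]].
Proof.
move=> [_ hS _] [[[cf [g [cg fK gK]]] _] [mFs mFu] tr [pFs pFu]
  [lambda [l1 ss su]]] [Sg1 Sg2].
have crs : crossing false Fu Fs.
  by move=> p; have [k [U [phi [*]]]] := tr p; exists k, U, phi.
have cru : crossing true Fs Fu.
  by move=> p; have [k [U [phi [*]]]] := tr p; exists k, U, phi.
have injf := can_inj fK.
have fS : f @` Sg = Sg.
  have [s0|/eqP/set0P sn] := pselect (sing Fs = set0); first by have []
    := Sg2 s0.
  by rewrite (Sg1 sn); case: pFs.
have fSg x : Sg (f x) <-> Sg x.
  split => [|Sx]; last by rewrite -fS; exists x.
  by rewrite -{1}fS => -[y Sy /injf <-].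
have finSg : finite_set Sg.
  have [s0|/eqP/set0P sn] := pselect (sing Fs = set0); first by have []
    := Sg2 s0.
  by rewrite (Sg1 sn); case: mFs.
apply: (finite_first_intersection_orbits hS crs cru mFs mFu finSg fK gK
  (transverse_crossing cf injf cru pFu l1 ss)
  (inverse_expanding cg fK gK crs pFs l1 su)) => //.
  by move=> x y; exact: preserves_leaf.
by move=> x y; apply: preserves_leaf; exact: preserves_foliation_inv pFu.
Qed.
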